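(* Let $q$ be a bounded complex-valued measurable function on $\mathbb R_+$, $\alpha\in\mathbb C\cup\{\infty\}$, and let $H$ be the operator $Hf=-f''+qf$ on $L^2(\mathbb R_+)$ with boundary condition $f'(0)+\alpha f(0)=0$. Let $\lambda>0$ be a simple eigenvalue of $|H|=\sqrt{H^*H}$. Then there exists a unique, up to multiplication by $\pm1$, normalised function $e\in L^2(\mathbb R_+)$ which satisfies the equation $$-e''+qe=\lambda\overline e$$ (with the complex conjugate of $e$ on the right-hand side) and the boundary condition $$e'(0)+\alpha e(0)=0.$$
   Context: $\mathbb R_+=(0,\infty)$. For $\alpha=\infty$ the boundary condition $f'(0)+\alpha f(0)=0$ means $f(0)=0$. The domain of the closed operator $H$ is the set of $f\in W^{2,2}([0,\infty))$ satisfying the boundary condition. ''Normalised'' means having norm one in $L^2(\mathbb R_+)$; a simple eigenvalue is one whose eigenspace is one-dimensional. *)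

(* Defs.v *)
From HB Require Import structures.
From mathcomp Require Import all_boot all_order all_algebra.
From mathcomp Require Import all_classical all_reals all_analysis.
From mathcomp Require Import measurable_realfun.
From mathcomp Require Import complex.

Set Implicit Arguments.
Unset Strict Implicit.
Unset Printing Implicit Defensive.

Import Order.TTheory GRing.Theory Num.Theory.
Import numFieldNormedType.Exports.

Local Open Scope classical_set_scope.
Local Open Scope ring_scope.
Local Open Scope complex_scope.

Section Defs.
Context {R : realType}.

Local Notation C := R[i].
Local Notation Re := (@complex.Re R).
Local Notation Im := (@complex.Im R).
Local Notation mu := (@lebesgue_measure R).

Implicit Types (f g h k : R -> C) (S T A : (R -> C) -> (R -> C) -> Prop).

Definition Rpos : set R := `]0, +oo[.
Definition Rnneg : set R := `[0, +oo[.

(* An element of L^2(0, oo) is represented by a total function [R -> C], of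
   which only the values on (0, oo) matter; equality in L^2 is [eqL2].  Each
   class has a Borel representative, so [L2] asks for Borel measurability. *)
Definition eqL2 f g : Prop := ae_eq mu Rpos f g.

Definition normsq (z : C) : R := Re z ^+ 2 + Im z ^+ 2.

Definition L2normsq f : \bar R :=
  (\int[mu]_(x in Rpos) (normsq (f x))%:E)%E.

Definition L2 f : Prop :=
  [/\ measurable_fun Rpos (fun x => Re (f x)),
      measurable_fun Rpos (fun x => Im (f x)) &
      (L2normsq f < +oo)%E].

Definition normalised f : Prop := L2normsq f = 1%E.

Definition Cintegral f : C :=
  (\int[mu]_(x in Rpos) Re (f x)) +i* (\int[mu]_(x in Rpos) Im (f x)).

Definition inner f g : C := Cintegral (fun x => f x * (g x)^*).

(* An unbounded operator on L^2 is given by its graph: [T f g] means that f is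
   in the domain of T and T f = g. *)
Definition densely_defined T : Prop :=
  forall h, L2 h -> forall eps : R, 0 < eps ->
  exists f g, T f g /\ (L2normsq (fun x => (f x - h x)%R) < eps%:E)%E.

Definition adjoint T h k : Prop :=
  [/\ L2 h, L2 k & forall f g, T f g -> inner g h = inner f k].

Definition opcomp S T f h : Prop := exists2 g, T f g & S g h.

(* Equality of the graphs of A and of its adjoint makes A linear, closed,
   single-valued and compatible with a.e. equality. *)
Definition self_adjoint A : Prop :=
  densely_defined A /\ (forall f g, A f g <-> adjoint A f g).

(* [0 <= z] in [R[i]] says that z is real and nonnegative. *)
Definition nonnegative A : Prop := forall f g, A f g -> 0 <= inner g f.

Definition is_sqrt A T : Prop :=
  [/\ self_adjoint A, nonnegative A & forall f h, opcomp A A f h <-> T f h].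

(* T^* T has exactly one nonnegative self-adjoint square root when T is closed
   and densely defined; it is |T|. *)
Definition is_modulus A T : Prop := is_sqrt A (opcomp (adjoint T) T).

Definition eigenspace T (lam : C) f : Prop := T f (fun x => lam * f x).

Definition simple_eigenvalue T (lam : C) : Prop :=
  exists f0, [/\ eigenspace T lam f0, ~ eqL2 f0 (fun=> 0) &
    forall f, eigenspace T lam f -> exists c : C, eqL2 f (fun x => c * f0 x)].

(* Real-valued functions in C^1_c(0, oo): phi is defined on the whole line, and
   0 < a keeps its support away from 0. *)
Definition test_function (phi : R -> R) : Prop :=
  [/\ forall x, derivable phi x 1, continuous (derive1 phi) &
      exists a b : R, 0 < a /\ forall x, ~ (a <= x <= b) -> phi x = 0].

Definition Clocally_integrable f : Prop :=
  locally_integrable Rpos (fun x => Re (f x)) /\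
  locally_integrable Rpos (fun x => Im (f x)).

Definition weak_derivative f g : Prop :=
  [/\ Clocally_integrable f, Clocally_integrable g &
    forall phi, test_function phi ->
      Cintegral (fun x => f x * (derive1 phi x)%:C) =
      - Cintegral (fun x => g x * (phi x)%:C)].

(* u is the representative of the class of f which is continuous on [0, oo);
   the boundary value f(0) is u 0. *)
Definition continuous_rep f u : Prop :=
  [/\ {within Rnneg, continuous (fun x => Re (u x))},
      {within Rnneg, continuous (fun x => Im (u x))} & eqL2 f u].

(* [f1] is the derivative of f; [None] stands for alpha = oo. *)
Definition boundary_condition (alpha : option C) f f1 : Prop :=
  exists u v, [/\ continuous_rep f u, continuous_rep f1 v &
    match alpha with
    | Some a => v 0 + a * u 0 = 0
    | None => u 0 = 0
    end].

(* The conditions on f, f1 = f' and f2 = f'' other than the boundary condition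
   say that f is in W^{2,2}. *)
Definition schrodinger (q : R -> C) (alpha : option C) f g : Prop :=
  [/\ L2 f, L2 g &
    exists f1 f2,
      [/\ weak_derivative f f1, weak_derivative f1 f2, L2 f1, L2 f2 &
          boundary_condition alpha f f1 /\
          eqL2 g (fun x => - f2 x + q x * f x)]].

(* e in L^2 solves - e'' + q e = lam e^* with the boundary condition at 0;
   e' and e'' are only required to be locally integrable. *)
Definition solves (q : R -> C) (alpha : option C) (lam : C) (e : R -> C)
    : Prop :=
  L2 e /\
  exists e1 e2,
    [/\ weak_derivative e e1, weak_derivative e1 e2,
        boundary_condition alpha e e1 &
        eqL2 (fun x => - e2 x + q x * e x) (fun x => lam * (e x)^*)].

(* Measurability of q is Lebesgue measurability, i.e. with respect to the
   completion of the Borel sigma-algebra. *)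
Definition Lebesgue_measurable_fun (p : R -> R) : Prop :=
  @measurable_fun _ _ (g_sigma_algebraType (completed_algebra_gen mu)) _ Rpos p.

Definition Cmeasurable (q : R -> C) : Prop :=
  Lebesgue_measurable_fun (fun x => Re (q x)) /\
  Lebesgue_measurable_fun (fun x => Im (q x)).

Definition Cbounded (q : R -> C) : Prop :=
  exists M : R, forall x, Rpos x -> `|q x| <= M%:C.

End Defs.

(* Main.v *)
(* Let J be complex conjugation.  The boundary terms of integration by parts cancel
   for two functions in the domain of H, which gives J H J <= H^*.  Conversely,
   let H^* g = k, put h = J g, and let W solve W'' = q h - J k with zero initial
   data.  Testing against compactly supported functions of the domain shows that
   h - W is orthogonal to every phi that is orthogonal to the affine function l
   satisfying the boundary condition; hence h = W + c l, and h lies in the domain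
   of H.  So H^* = J H J.

   Let |H| f = lam f with f <> 0.  Then H^* H (J H f) = H^* (lam^2 J f) =
   lam^2 J H f, so J H f is a multiple of f by simplicity: H f = d J f, and
   |d| = lam since |H f|^2 = (H^* H f, f).  Multiplying f by a phase turns d into
   lam.  Conversely, a solution e' of H e' = lam J e' satisfies H^* H e' = lam^2 e',
   so it is a multiple k e of e, and the symmetry of (u, v) |-> int u H v, applied
   to e and e', makes k real.  A solution in L^2 belongs to the domain of H because
   u, u'' in L^2 imply u' in L^2. *)

Require Import Defs.
From mathcomp Require Import all_boot all_order all_algebra.
From mathcomp Require Import all_classical all_reals all_analysis.
From mathcomp Require Import measurable_realfun.
From mathcomp Require Import complex.
From mathcomp Require Import ring lra.

Set Implicit Arguments.
Unset Strict Implicit.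
Unset Printing Implicit Defensive.

Import Order.TTheory GRing.Theory Num.Theory.
Import numFieldNormedType.Exports.

Local Open Scope classical_set_scope.
Local Open Scope complex_scope.
Local Open Scope ring_scope.

(** * Primitives on the half-line *)

Section Primitive.
Context {R : realType}.
Local Notation mu := (@lebesgue_measure R).
Implicit Types (f g h : R -> R) (D : set R).

(** The weak formulation is left behind as early as possible. A du Bois-Reymond argument turns a
    function with two weak derivatives into an explicit double primitive [sol0 c0 c1 h]. The
    boundary condition is then a linear relation between the constants [c0] and [c1], integration by
    parts is Fubini on a triangle, and the boundary term at 0 is a determinant of initial data. The
    obstacle is the other end: the boundary term at infinity vanishes because it is an integrable
    function with a limit, and its integrability rests on [f'] being in L^2. Nothing controls the
    growth of [W] and of the affine function, so the orthogonality argument for the adjoint is run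
    on bounded intervals and the pieces are glued. Two mismatches between the definitions are
    bridged as well. [q] is Lebesgue measurable while [L2] asks for Borel measurability, which calls
    for a Borel representative [q']. Simplicity is a property of [|H|] while the antilinear argument
    produces eigenfunctions of [H^* H], so [lam^2] is brought down to [lam] by positivity of the
    root. *)

Definition integ D f := mu.-integrable D (EFin \o f).

Lemma integ_measurable D f : integ D f -> measurable_fun D f.
Proof. by move=> /measurable_int/measurable_EFinP. Qed.

Lemma eq_integ D f g : {in D, f =1 g} -> measurable D -> integ D f -> integ D g.
Proof. by move=> fg mD; apply: eq_integrable => // x xD /=; rewrite fg. Qed.

Lemma integD D f g : measurable D -> integ D f -> integ D g ->
  integ D (fun x => f x + g x).
Proof. by move=> mD fD gD; exact: (@integrableD _ _ _ mu D mD _ _ fD gD). Qed.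

Lemma integZ D (k : R) f : measurable D -> integ D f ->
  integ D (fun x => k * f x).
Proof. by move=> mD fD; exact: (@integrableZl _ _ _ mu D mD k _ fD). Qed.

Lemma integB D f g : measurable D -> integ D f -> integ D g ->
  integ D (fun x => f x - g x).
Proof. by move=> mD fD gD; exact: (@integrableB _ _ _ mu D mD _ _ fD gD). Qed.

Lemma integS D E f : measurable D -> measurable E -> D `<=` E ->
  integ E f -> integ D f.
Proof. by move=> mD mE DE; apply: integrableS. Qed.

Lemma integ_restrict D f : measurable D -> integ D f <-> integ setT (f \_ D).
Proof.
by move=> mD; rewrite /integ -restrict_EFin; exact: (@integrable_mkcond _ _ _ mu D _ mD).
Qed.

Lemma le_integ D f g : measurable D -> measurable_fun D f ->
  (forall x, D x -> `|f x| <= g x) -> integ D g -> integ D f.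
Proof.
move=> mD mf fg; apply: le_integrable => //; first exact/measurable_EFinP.
move=> x Dx /=; rewrite lee_fin (le_trans (fg x Dx))//; exact: ler_norm.
Qed.

Lemma integ_mul_bounded D f g (M : R) : measurable D -> integ D f ->
  measurable_fun D g -> (forall x, D x -> `|g x| <= M) ->
  integ D (fun x => f x * g x).
Proof.
move=> mD fD mg gM.
apply: (@le_integ _ _ (fun x => M * `|f x|)) => //.
- by apply: measurable_funM => //; exact: integ_measurable.
- by move=> x Dx; rewrite normrM mulrC ler_wpM2r// gM.
- by apply: integZ => //; exact: integrable_norm.
Qed.

Lemma EFin_Rintegral D f : measurable D -> integ D f ->
  (\int[mu]_(x in D) (f x)%:E)%E = (\int[mu]_(x in D) f x)%:E.
Proof. by move=> mD fD; rewrite fineK//; exact: (@integrable_fin_num _ _ _ mu). Qed.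

Lemma RintegralZ D (k : R) f : measurable D -> integ D f ->
  \int[mu]_(x in D) (k * f x) = k * \int[mu]_(x in D) f x.
Proof. by move=> mD fD; apply: RintegralZl. Qed.

(* Integrability up to the endpoint 0, which [locally_integrable Rpos] does not give. *)
Definition locint0 g := forall N, integ `]0, N] g.

Definition prim g x := \int[mu]_(t in `]0, x]) g t.

Lemma prim_le0 g x : x <= 0 -> prim g x = 0.
Proof. by move=> x0; rewrite /prim set_itv_ge ?Rintegral_set0// bnd_simp -leNgt. Qed.

Lemma integ_itv_cst (a b k : R) : integ `]a, b] (cst k).
Proof.
apply: measurable_bounded_integrable => //=.
  by rewrite lebesgue_measure_itv/= -?EFinD; case: ifPn => // _; exact: ltry.
exists `|k|; split=> // M kM x _ /=; exact: ltW.
Qed.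

Lemma prim_continuous g : locint0 g -> continuous (prim g).
Proof.
move=> ig x.
(* The interval [[-b, b]] has [x] in its interior. Once [g] is cut off outside []0, b]], the
   integral from [-b] agrees with [prim g] near [x], also for negative arguments, where both
   vanish. *)
pose b := `|x| + 1.
have b0 : 0 < b by rewrite /b ltr_pwDr.
have xb : x \in `]-b, b[.
  by rewrite in_itv/= -ltr_norml /b ltrDl.
pose g0 := g \_ `]0, b].
have ig0 : integ setT g0 by apply: (integ_restrict _ _).1.
have ig1 : mu.-integrable `[-b, b] (EFin \o g0) by apply: (@integS _ setT).
have bb : -b < b by rewrite gtrN.
have := @parameterized_integral_continuous R (-b) b g0 (ltW bb) ig1.
move/(within_continuous_continuous bb) => /(_ _ xb).
rewrite /prop_for /continuous_at /parameterized_integral.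
have E y : y \in `]-b, b[ -> \int[mu]_(t in `[-b, y]) g0 t = prim g y.
  rewrite in_itv/= => /andP[by_ yb].
  rewrite /g0 -Rintegral_mkcondr; congr (Rintegral _ _ _).
  apply/seteqP; split => t /=; rewrite !in_itv/=.
    by move=> [/andP[? ?] /andP[? ?]]; lra.
  by move=> /andP[? ?]; split; lra.
rewrite E// => H; apply: cvg_trans H.
apply: near_eq_cvg; near=> y; rewrite E//.
by near: y; apply: near_in_itvoo.
Unshelve. all: by end_near. Qed.

Lemma prim_measurable D g : measurable D -> locint0 g ->
  measurable_fun D (prim g).
Proof.
move=> mD ig; apply: measurable_funS (continuous_measurable_fun (prim_continuous ig)) => //.
Qed.

Lemma prim_norm_le g N x : locint0 g -> x <= N ->
  `|prim g x| <= prim (fun t => `|g t|) N.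
Proof.
move=> ig xN; apply: le_trans (le_normr_Rintegral _ (ig x)) _ => //.
rewrite /prim /Rintegral fine_le//.
- by apply: (@integrable_fin_num _ _ _ mu) => //; exact: (integrable_norm (ig x)).
- by apply: (@integrable_fin_num _ _ _ mu) => //; exact: (integrable_norm (ig N)).
apply: ge0_subset_integral => //.
  by apply/measurable_EFinP; exact: (integ_measurable (integrable_norm (ig N))).
by move=> t /=; rewrite !in_itv/= => /andP[-> tx]/=; exact: le_trans xN.
Qed.

Lemma integ_mul_prim f g N : locint0 f -> locint0 g ->
  integ `]0, N] (fun x => f x * prim g x).
Proof.
move=> lf lg.
apply: (@integ_mul_bounded _ _ _ (prim (fun t => `|g t|) N)) => //.
- exact: prim_measurable.
- by move=> x /=; rewrite in_itv/= => /andP[_ xN]; exact: prim_norm_le.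
Qed.

(* Fubini on the triangle [y < x]. *)
Lemma prim_parts f g N : locint0 f -> locint0 g ->
  \int[mu]_(x in `]0, N]) (f x * prim g x) +
  \int[mu]_(x in `]0, N]) (g x * prim f x) = prim f N * prim g N.
Proof.
move=> lf lg.
pose f0 := f \_ `]0, N]; pose g0 := g \_ `]0, N].
have if0 : integ setT f0 by apply: (integ_restrict _ _).1.
have ig0 : integ setT g0 by apply: (integ_restrict _ _).1.
have mf0 : measurable_fun setT (f0 : measurableTypeR R -> R).
  exact: integ_measurable.
have mg0 : measurable_fun setT (g0 : measurableTypeR R -> R).
  exact: integ_measurable.
(* [K] lives on the triangle [y < x]: integrating in [y] first produces [prim g x], integrating in
   [x] first produces the integral of [f] over []y, N]]. *)
pose K (z : measurableTypeR R * measurableTypeR R) : R :=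
  if (z.2 : R) < z.1 then f0 z.1 * g0 z.2 else 0.
have mK : measurable_fun setT K.
  apply: measurable_fun_ifT => //.
    by apply: measurable_fun_ltr; [exact: measurable_snd|exact: measurable_fst].
  apply: measurable_funM.
    by apply: measurableT_comp measurable_fst.
  by apply: measurableT_comp measurable_snd.
have mfE : measurable_fun setT (fun x : measurableTypeR R => `|f0 x|%:E).
  by apply/measurable_EFinP/measurableT_comp.
have mgE : measurable_fun setT (fun x : measurableTypeR R => `|g0 x|%:E).
  by apply/measurable_EFinP/measurableT_comp.
have ifE : (\int[mu]_x (`|f0 x|%:E) < +oo)%E by move/integrableP : if0 => [].
have igE : (\int[mu]_x (`|g0 x|%:E) < +oo)%E by move/integrableP : ig0 => [].
have iK : (mu \x mu)%E.-integrable setT (EFin \o K).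
  apply/integrable12ltyP; first exact/measurable_EFinP.
  (* Tonelli: dropping the indicator of the triangle bounds the double integral by a product of two
     finite integrals. *)
  apply: (@le_lt_trans _ _ (\int[mu]_x (`|f0 x|%:E * \int[mu]_y (`|g0 y|%:E)))%E).
    apply: ge0_le_integral => //.
    - by move=> x _; apply: integral_ge0.
    - apply: (@measurable_fun_fubini_tonelli_F _ _ _ _ _ mu (fun z => `|(K z)%:E|)%E) => //.
      by do 2 apply: measurableT_comp => //.
    - under eq_fun do rewrite muleC.
      rewrite -(fineK (_ : (\int[mu]_y (`|g0 y|)%:E)%E \is a fin_num)); last first.
        by rewrite ge0_fin_numE//; apply: integral_ge0.
      exact: measurable_funeM.
    - move=> x _; rewrite -ge0_integralZl//.
      apply: ge0_le_integral => //.
      + by apply: measurableT_comp => //; apply/measurable_EFinP; exact: measurableT_comp mK _.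
      + exact: measurable_funeM.
      + move=> y _; rewrite /K/=; case: ifPn => _; first by rewrite -EFinM normrM.
        by rewrite normr0 -EFinM lee_fin mulr_ge0.
  rewrite ge0_integralZr//; last exact: integral_ge0.
  rewrite lte_mul_pinfty//; first exact: integral_ge0.
  by rewrite ge0_fin_numE//; exact: integral_ge0.
have := Fubini iK.
have -> : (\int[mu]_x \int[mu]_y (EFin \o K) (x, y) =
   \int[mu]_x (((fun x => f x * prim g x) \_ `]0, N]) x)%:E)%E.
  apply: eq_integral => x _.
  rewrite patchE; case: ifPn => xN; last first.
    rewrite integral0_eq// => y _ /=; rewrite /K/= /f0 patchE (negbTE xN) mul0r.
    by case: ifPn.
  have xN' : 0 < x <= N by move: xN; rewrite inE/= in_itv.
  have ig : integ `]0, x[ g.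
    apply: (@integS _ `]0, N]) => // t /=; rewrite !in_itv/=; lra.
  transitivity (\int[mu]_y (f x * (g \_ `]0, x[) y)%:E)%E.
    apply: eq_integral => y _; rewrite /= /K/= /f0 patchE xN /g0 !patchE.
    case: ifPn => yx; last first.
      by rewrite ifF ?mulr0//; apply/negbTE; rewrite notin_setE/= in_itv/= (negbTE yx) andbF.
    congr (_ * _)%:E; apply/esym.
    case: ifPn; rewrite ?inE ?notin_setE/= in_itv/= => H.
      by rewrite ifT// inE/= in_itv/=; lra.
    by rewrite ifF//; apply/negbTE; rewrite notin_setE/= in_itv/=; apply/negP; lra.
  rewrite EFin_Rintegral//; last by apply: integZ => //; exact: (integ_restrict _ _).1.
  rewrite RintegralZ//; last exact: (integ_restrict _ _).1.
  by rewrite -Rintegral_mkcond Rintegral_itv_bndo_bndc.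
have -> : (\int[mu]_y \int[mu]_x (EFin \o K) (x, y) =
   \int[mu]_y (((fun y => g y * (prim f N - prim f y)) \_ `]0, N]) y)%:E)%E.
  apply: eq_integral => y _.
  rewrite patchE; case: ifPn => yN; last first.
    rewrite integral0_eq// => x _ /=; rewrite /K/= /g0 patchE (negbTE yN) mulr0.
    by case: ifPn.
  have yN' : 0 < y <= N by move: yN; rewrite inE/= in_itv.
  have if' : integ `]y, N] f.
    apply: (@integS _ `]0, N]) => // t /=; rewrite !in_itv/=; lra.
  transitivity (\int[mu]_x (g y * (f \_ `]y, N]) x)%:E)%E.
    apply: eq_integral => x _; rewrite /= /K/= /g0 patchE yN /f0 !patchE mulrC.
    case: ifPn => yx; last first.
      by rewrite ifF ?mulr0//; apply/negbTE; rewrite notin_setE/= in_itv/= (negbTE yx).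
    congr (_ * _)%:E; apply/esym.
    case: ifPn; rewrite ?inE ?notin_setE/= in_itv/= => H.
      by rewrite ifT// inE/= in_itv/=; lra.
    by rewrite ifF//; apply/negbTE; rewrite notin_setE/= in_itv/=; apply/negP; lra.
  rewrite EFin_Rintegral//; last by apply: integZ => //; exact: (integ_restrict _ _).1.
  rewrite RintegralZ//; last exact: (integ_restrict _ _).1.
  rewrite -Rintegral_mkcond /prim Rintegral_itvB// ?bnd_simp; last 2 first.
  - by case/andP: yN' => /ltW.
  - by case/andP: yN'.
  exact: lf.
have i1 := integ_mul_prim N lf lg.
have i2 := integ_mul_prim N lg lf.
have i3 : integ `]0, N] (fun y => g y * (prim f N - prim f y)).
  apply: (@eq_integ _ (fun y => prim f N * g y - g y * prim f y)) => //.
    by move=> y _; ring.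
  by apply: integB => //; apply: integZ => //; exact: lg.
rewrite !EFin_Rintegral//; [|exact: (integ_restrict _ _).1..].
rewrite -!Rintegral_mkcond => -[->].
rewrite -RintegralD//.
have -> : prim f N * prim g N = \int[mu]_(x in `]0, N]) (prim f N * g x).
  by rewrite RintegralZ.
by apply: eq_Rintegral => x _; ring.
Qed.

Lemma locint0D f g : locint0 f -> locint0 g -> locint0 (fun x => f x + g x).
Proof. by move=> lf lg N; apply: integD. Qed.

Lemma locint0B f g : locint0 f -> locint0 g -> locint0 (fun x => f x - g x).
Proof. by move=> lf lg N; apply: integB. Qed.

Lemma locint0_cst k : locint0 (cst k).
Proof. by move=> N; exact: integ_itv_cst. Qed.

Lemma locint0_mul_prim f g d : locint0 f -> locint0 g ->
  locint0 (fun x => f x * (d + prim g x)).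
Proof.
move=> lf lg N; apply: (@eq_integ _ (fun x => d * f x + f x * prim g x)) => //.
  by move=> x _; ring.
by apply: integD => //; [exact: integZ|exact: integ_mul_prim].
Qed.

Lemma locint0_prim c g : locint0 g -> locint0 (fun x => c + prim g x).
Proof.
move=> lg N; apply: (@eq_integ _ (fun x => cst 1 x * (c + prim g x))) => //.
  by move=> x _; rewrite mul1r.
exact: (locint0_mul_prim _ (locint0_cst 1)).
Qed.

Lemma primD f g x : locint0 f -> locint0 g ->
  prim (fun t => f t + g t) x = prim f x + prim g x.
Proof. by move=> lf lg; rewrite /prim RintegralD//; [exact: lf|exact: lg]. Qed.

Lemma primB f g x : locint0 f -> locint0 g ->
  prim (fun t => f t - g t) x = prim f x - prim g x.
Proof. by move=> lf lg; rewrite /prim RintegralB//; [exact: lf|exact: lg]. Qed.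

Lemma primZ k f x : locint0 f -> prim (fun t => k * f t) x = k * prim f x.
Proof. by move=> lf; rewrite /prim RintegralZ. Qed.

Lemma eq_prim f g x : (forall t, 0 < t <= x -> f t = g t) -> prim f x = prim g x.
Proof. by move=> fg; apply: eq_Rintegral => t; rewrite inE/= in_itv/=; exact: fg. Qed.

(** The product rule in integrated form: for [u = c + prim f] and [v = d + prim g] the integrand is
    [(u v)']. Expanding the constants leaves exactly [prim_parts]. *)
Lemma prim_prod c d f g N : locint0 f -> locint0 g ->
  prim (fun x => f x * (d + prim g x) + g x * (c + prim f x)) N =
  (c + prim f N) * (d + prim g N) - c * d.
Proof.
move=> lf lg.
have i1 := integ_mul_prim N lf lg.
have i2 := integ_mul_prim N lg lf.
rewrite (@eq_prim _ (fun x => (d * f x + c * g x) +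
    (f x * prim g x + g x * prim f x))); last first.
  by move=> t _; ring.
rewrite /prim RintegralD//=; last 2 first.
- by apply: integD => //; apply: integZ.
- by apply: integD.
rewrite RintegralD//; last 2 first.
- by apply: integZ.
- by apply: integZ.
rewrite [X in _ + X]RintegralD// prim_parts// !RintegralZ// -/(prim _ _) -/(prim _ _).
ring.
Qed.

Lemma prim_sub g x y : locint0 g -> 0 <= x -> x <= y ->
  \int[mu]_(t in `]x, y]) g t = prim g y - prim g x.
Proof.
move=> lg x0 xy; rewrite /prim Rintegral_itvB// ?bnd_simp//.
exact: lg.
Qed.

(** * Integrals over the whole half-line and limits at infinity *)

Lemma measurable_Rpos : measurable (Rpos : set R).
Proof. exact: measurable_itv. Qed.

Local Hint Resolve measurable_Rpos : core.

Lemma RposP (x : R) : Rpos x <-> 0 < x.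
Proof. by rewrite /Rpos /= in_itv/= andbT. Qed.

Lemma subset_Rpos (M N : R) : 0 <= M -> `]M, N]%classic `<=` Rpos.
Proof. by move=> M0 x /=; rewrite in_itv/= RposP => /andP[+ _]; exact: le_lt_trans. Qed.

Lemma Rpos_bigcup : Rpos = \bigcup_(n in [set: nat]) `]0, n%:R]%classic :> set R.
Proof.
apply/seteqP; split => [x /RposP x0|x [n _]] /=; last first.
  by rewrite in_itv/= => /andP[x0 _]; apply/RposP.
exists (Num.bound x) => //=; rewrite in_itv/= x0 ltW//.
exact: archi_boundP (ltW x0).
Qed.

Lemma integ_Rpos_locint0 g : integ Rpos g -> locint0 g.
Proof. by move=> ig N; apply: integS ig => //; apply: subset_Rpos. Qed.

(** Monotone convergence along the exhaustion of the half-line by []0, n]]. *)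
Lemma integ_Rpos_bounded g B : (forall x : R, 0 < x -> 0 <= g x) -> locint0 g ->
  (forall n : nat, prim g n%:R <= B) ->
  integ Rpos g /\ \int[mu]_(x in Rpos) g x <= B.
Proof.
move=> g0 lg gB.
have mg : measurable_fun Rpos g.
  rewrite Rpos_bigcup; apply/measurable_fun_bigcup => // n.
  exact: integ_measurable (lg _).
pose F (n : nat) : set R := `]0, n%:R]%classic.
have ndF : nondecreasing_seq F.
  move=> m n mn; apply/subsetPset => t; rewrite /F/= !in_itv/= => /andP[-> tm]/=.
  by apply: le_trans tm _; rewrite ler_nat.
have mF n : measurable (F n) by exact: measurable_itv.
have F0 n x : F n x -> (0 <= (EFin \o g) x)%E.
  by rewrite /F/= in_itv/= lee_fin => /andP[x0 _]; exact: g0.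
have mgF n : measurable_fun (F n) (EFin \o g).
  by apply/measurable_EFinP; exact: integ_measurable (lg _).
have H : (\int[mu]_(x in Rpos) (g x)%:E <= B%:E)%E.
  have := @ge0_nondecreasing_set_cvg_integral _ (measurableTypeR R) R F
    (EFin \o g) mu ndF mF mgF F0.
  rewrite -[\bigcup_i F i]Rpos_bigcup => /cvg_lim <- //.
  apply: lime_le.
    apply: ereal_nondecreasing_is_cvgn.
    exact: (@ge0_nondecreasing_set_nondecreasing_integral _ (measurableTypeR R) R F
      (EFin \o g) mu ndF mF mgF F0).
  by apply: nearW => n; rewrite EFin_Rintegral//; [rewrite lee_fin; exact: gB|exact: lg].
have ig : integ Rpos g.
  apply/integrableP; split; first exact/measurable_EFinP.
  under eq_integral => x.
    rewrite inE => /RposP x0; rewrite /= ger0_norm ?g0//.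
    over.
  exact: le_lt_trans H (ltry _).
split=> //.
by rewrite -lee_fin -EFin_Rintegral.
Qed.

Lemma prim_tail_lt g (e : R) : integ Rpos g -> 0 < e ->
  exists2 N, 0 < N & forall x, N <= x ->
    `|prim g x - \int[mu]_(t in Rpos) g t| < e.
Proof.
move=> ig e0.
have ing := integrable_norm ig : integ Rpos (fun x => `|g x|).
have lg := integ_Rpos_locint0 ig.
have lng := integ_Rpos_locint0 ing.
(* If no [n] worked, [integ_Rpos_bounded] would bound the integral of [|g|] by itself minus [e]. *)
have [n Hn] : exists n : nat, \int[mu]_(t in Rpos) `|g t| - e < prim (fun t => `|g t|) n%:R.
  apply: contrapT => /forallNP H.
  have {}H n : prim (fun t => `|g t|) n%:R <= \int[mu]_(t in Rpos) `|g t| - e.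
    by rewrite leNgt; apply/negP/H.
  have [_] := integ_Rpos_bounded (fun t _ => normr_ge0 (g t)) lng H.
  by rewrite leNgt ltrBlDr ltrDl e0.
exists (n%:R + 1) => [|x nx]; first by rewrite ltr_wpDl.
have x0 : 0 <= x by apply: le_trans nx; rewrite addr_ge0.
have tl h : integ Rpos h -> \int[mu]_(t in Rpos) h t - prim h x =
    \int[mu]_(t in `]x, +oo[) h t.
  by move=> ih; rewrite /prim Rintegral_itvB// bnd_simp.
have ix h : integ Rpos h -> integ `]x, +oo[ h.
  by apply: integS => // t /=; rewrite RposP in_itv/= andbT; exact: le_lt_trans.
rewrite distrC tl//.
apply: le_lt_trans (le_normr_Rintegral _ (ix _ ig)) _ => //.
rewrite -tl//.
suff : prim (fun t => `|g t|) n%:R <= prim (fun t => `|g t|) x by lra.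
rewrite -subr_ge0 -prim_sub//; first exact: Rintegral_ge0.
by apply: le_trans nx; rewrite lerDl.
Qed.

(** An interval of length [n] to the right of [N] contributes at least [c * n] to the integral of
    [|h|], for every [n]. *)
Lemma integ_Rpos_not_bounded_below h (c N : R) : 0 < c ->
  (forall x, N <= x -> c <= `|h x|) -> integ Rpos h -> False.
Proof.
move=> c0 hc ih.
pose M := Num.max N 0.
pose J := \int[mu]_(t in Rpos) `|h t|.
have ing := integrable_norm ih : integ Rpos (fun x => `|h x|).
have J0 : 0 <= J by exact: Rintegral_ge0.
have K (n : nat) : c * n%:R <= J.
  have Mn : M <= M + n%:R by rewrite lerDl.
  have M0 : 0 <= M by rewrite /M le_max lexx orbT.
  have sub : `]M, M + n%:R]%classic `<=` Rpos.
    exact: subset_Rpos.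
  have -> : c * n%:R = \int[mu]_(t in `]M, M + n%:R]) c.
    rewrite Rintegral_cst//= lebesgue_measure_itv/= lte_fin.
    case: ifPn => /=; last first.
      by rewrite ltrDl -leNgt => H; congr (_ * _); apply/eqP; rewrite eq_le H ler0n.
    by move=> _; rewrite addrC addKr.
  apply: (@le_trans _ _ (\int[mu]_(t in `]M, M + n%:R]) `|h t|)).
    apply: le_Rintegral => //.
    - exact: integ_itv_cst.
    - exact: integS ing.
    - move=> t /=; rewrite in_itv/= => /andP[Mt _]; apply: hc.
      by apply: ltW; apply: le_lt_trans Mt; rewrite /M le_max lexx.
  rewrite /J /Rintegral fine_le//.
  - by apply: (@integrable_fin_num _ _ _ mu) => //; exact: (integS _ _ sub ing).
  - by apply: (@integrable_fin_num _ _ _ mu).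
  - apply: ge0_subset_integral => //.
    by apply/measurable_EFinP; exact: (integ_measurable ing).
have := archi_boundP (_ : 0 <= J / c).
rewrite divr_ge0//; last exact: ltW.
move=> /(_ isT); rewrite ltr_pdivrMr// mulrC => H.
by have := K (Num.bound (J / c)); rewrite leNgt H.
Qed.

(** The function [a + prim g] tends to [L], the sum of [a] and the integral of [g]. If [L] were
    nonzero, it would eventually stay above [|L| / 2] in absolute value and could not be integrable.
    This is what removes boundary terms at infinity. *)
Lemma integral_derivative_Rpos a g : integ Rpos (fun x => a + prim g x) ->
  integ Rpos g -> \int[mu]_(x in Rpos) g x = - a.
Proof.
move=> iw ig; apply/eqP; rewrite -subr_eq0 opprK addrC; apply/negP => /negP L0.
set L := a + _ in L0.
have L20 : 0 < `|L| / 2 by rewrite divr_gt0 ?normr_gt0.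
have [N N0 HN] := prim_tail_lt ig L20.
apply: (@integ_Rpos_not_bounded_below _ _ N L20 _ iw) => x Nx.
have := HN _ Nx.
have : `|L| <= `|a + prim g x| + `|prim g x - \int[mu]_(t in Rpos) g t|.
  have -> : L = (a + prim g x) - (prim g x - \int[mu]_(t in Rpos) g t) by rewrite /L; ring.
  exact: ler_normB.
lra.
Qed.

(** * Square-integrable real functions *)

Definition L2r f := measurable_fun Rpos f /\ integ Rpos (fun x => f x ^+ 2).

Lemma L2r_mul f g : L2r f -> L2r g -> integ Rpos (fun x => f x * g x).
Proof.
move=> [mf if2] [mg ig2].
apply: (@le_integ _ _ (fun x => f x ^+ 2 + g x ^+ 2)) => //.
- exact: measurable_funM.
- move=> x _; rewrite ler_norml; apply/andP; split; nra.
- exact: integD.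
Qed.

Lemma L2r_locint0 f : L2r f -> locint0 f.
Proof.
move=> [mf if2] N.
apply: (@le_integ _ _ (fun x => 1 + f x ^+ 2)) => //.
- by apply: measurable_funS mf => //; exact: subset_Rpos.
- move=> x _; rewrite ler_norml; apply/andP; split; nra.
- by apply: integD => //; [exact: integ_itv_cst|exact: integ_Rpos_locint0].
Qed.

Lemma L2rD f g : L2r f -> L2r g -> L2r (fun x => f x + g x).
Proof.
move=> Lf Lg; have [mf if2] := Lf; have [mg ig2] := Lg.
have ifg := L2r_mul Lf Lg.
split; first exact: measurable_funD.
apply: (@eq_integ _ (fun x => (f x ^+ 2 + g x ^+ 2) + 2 * (f x * g x))) => //.
  by move=> x _; ring.
by apply: integD => //; [exact: integD|exact: integZ].
Qed.

Lemma L2rZ k f : L2r f -> L2r (fun x => k * f x).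
Proof.
move=> [mf if2]; split; first exact: measurable_funM.
apply: (@eq_integ _ (fun x => k ^+ 2 * f x ^+ 2)) => //.
  by move=> x _; ring.
exact: integZ.
Qed.

Lemma L2r_bounded_mul f g (M : R) : measurable_fun Rpos g ->
  (forall x : R, 0 < x -> `|g x| <= M) -> L2r f -> L2r (fun x => g x * f x).
Proof.
move=> mg gM [mf if2]; split; first exact: measurable_funM.
apply: (@le_integ _ _ (fun x => M ^+ 2 * f x ^+ 2)) => //.
- by apply: measurable_funX; apply: measurable_funM.
- move=> x /RposP/gM gx.
  rewrite ger0_norm ?sqr_ge0// exprMn ler_wpM2r ?sqr_ge0//.
  by rewrite -(real_normK (num_real (g x))) lerXn2r ?nnegrE// (le_trans _ gx).
- exact: integZ.
Qed.

(* With [u' = v] and [v' = g], [u v - d c] is the sum of the integrals of [v^2]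
   and [u g].  If the former diverged, [(u^2)' = 2 u v] would eventually exceed 2
   and [u^2] would not be integrable. *)
Lemma L2r_interpolation c d g :
  L2r (fun x => d + prim (fun t => c + prim g t) x) -> L2r g ->
  L2r (fun x => c + prim g x).
Proof.
set v := fun t => c + prim g t; set u := fun x => d + prim v x => Lu Lg.
have lg := L2r_locint0 Lg.
have lv : locint0 v by exact: locint0_prim.
have mv : measurable_fun Rpos v by apply: measurable_funD => //; apply: prim_measurable.
have lv2 : locint0 (fun x => v x * v x) by exact: locint0_mul_prim.
have iug := L2r_mul Lu Lg.
have lug := integ_Rpos_locint0 iug.
have E1 N : prim (fun x => v x * v x) N + prim (fun x => u x * g x) N = u N * v N - d * c.
  rewrite -primD// -[RHS](prim_prod d c N lv lg).
  by apply: eq_prim => t _; rewrite -/(v t) -/(u t); ring.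
have lvu : locint0 (fun x => v x * u x) by exact: locint0_mul_prim.
have E2 N : 2 * prim (fun x => v x * u x) N = u N * u N - d * d.
  rewrite -primZ// -(prim_prod d d N lv lv).
  by apply: eq_prim => t _; rewrite -/(v t) -/(u t); ring.
suff [B HB] : exists B, forall n : nat, prim (fun x => v x * v x) n%:R <= B.
  have [iv _] := @integ_Rpos_bounded _ B (fun x _ => sqr_ge0 (v x)) lv2 HB.
  by split.
apply: contrapT => /forallNP H.
pose K := \int[mu]_(x in Rpos) `|u x * g x|.
have Kx x : `|prim (fun x => u x * g x) x| <= K.
  apply: le_trans (le_normr_Rintegral _ (lug x)) _ => //.
  rewrite /K /Rintegral fine_le//.
  - by apply: (@integrable_fin_num _ _ _ mu) => //; exact: (integrable_norm (lug x)).
  - by apply: (@integrable_fin_num _ _ _ mu) => //; exact: (integrable_norm iug).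
  - apply: ge0_subset_integral => //; last by apply: subset_Rpos.
    by apply/measurable_EFinP; exact: (integ_measurable (integrable_norm iug)).
(* The threshold is tuned to [E1]: from [n] on, the integral of [v^2] outweighs that of [u g],
   bounded by [K], so that [u v] is at least 1. *)
have [n Hn] : exists n : nat, K + 1 - d * c < prim (fun x => v x * v x) n%:R.
  have /existsNP[n Hn] := H (K + 1 - d * c).
  by exists n; rewrite ltNge; apply/negP.
have uv1 x : n%:R <= x -> 1 <= v x * u x.
  move=> nx.
  have : prim (fun x => v x * v x) n%:R <= prim (fun x => v x * v x) x.
    by rewrite -subr_ge0 -prim_sub//; apply: Rintegral_ge0 => t _; exact: sqr_ge0.
  have := Kx x; rewrite ler_norml => /andP[]; have := E1 x; lra.
(* One unit past [n], the integral of [2 u v] from [n] has reached 2, so [u^2] is at least 2 by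
   [E2]. *)
apply: (@integ_Rpos_not_bounded_below (fun x => u x ^+ 2) 2 (n%:R + 1)) => //;
  last by case: Lu.
move=> x nx.
have nx' : n%:R <= x by apply: le_trans nx; rewrite lerDl.
have I : x - n%:R <= \int[mu]_(t in `]n%:R, x]) (v t * u t).
  have -> : x - n%:R = \int[mu]_(t in `]n%:R, x]) 1.
    rewrite Rintegral_cst//= lebesgue_measure_itv/= lte_fin.
    by rewrite ifT/= ?mul1r//; lra.
  apply: le_Rintegral => //.
  - exact: integ_itv_cst.
  - apply: (integS _ _ _ (lvu x)) => // t /=; rewrite !in_itv/= => /andP[nt ->].
    by rewrite (le_lt_trans _ nt).
  - by move=> t /=; rewrite in_itv/= => /andP[/ltW nt _]; exact: uv1.
rewrite prim_sub// in I.
rewrite ger0_norm ?sqr_ge0//.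
have := E2 x; have := E2 n%:R; have := sqr_ge0 (u n%:R); rewrite !expr2; lra.
Qed.

End Primitive.

(** * Weak derivatives of real functions *)

Section Weak.
Context {R : realType}.
Local Notation mu := (@lebesgue_measure R).
Implicit Types (f g h phi psi : R -> R) (D : set R) (a b x : R).

Local Hint Resolve measurable_Rpos : core.

Lemma continuous_integ phi a b : continuous phi -> integ `[a, b] phi.
Proof.
move=> cphi; apply: continuous_compact_integrable; first exact: segment_compact.
exact: continuous_subspaceT.
Qed.

Lemma continuous_locint0 phi : continuous phi -> locint0 phi.
Proof.
move=> cphi N; apply: integS (continuous_integ 0 N cphi) => //.
by move=> t /=; rewrite !in_itv/= => /andP[/ltW -> ->].
Qed.

Lemma Rintegral_support D E f : E `<=` D -> (forall x, D x -> ~ E x -> f x = 0) ->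
  \int[mu]_(x in D) f x = \int[mu]_(x in E) f x.
Proof.
move=> ED f0; rewrite Rintegral_mkcond [RHS]Rintegral_mkcond.
apply: eq_Rintegral => x _; rewrite !patchE.
case: ifPn => [|]; rewrite ?inE ?notin_setE => Dx;
  case: ifPn => //; rewrite ?inE ?notin_setE => Ex.
- exact: f0.
- by case: Dx; exact: ED.
Qed.

Lemma integ_support D E f : measurable D -> measurable E -> E `<=` D ->
  (forall x, D x -> ~ E x -> f x = 0) -> integ E f -> integ D f.
Proof.
move=> mD mE ED f0 iE; apply/(integ_restrict _ mD).
have := (integ_restrict f mE).1 iE.
apply: eq_integ => // x _; rewrite !patchE.
case: ifPn => [|]; rewrite ?inE ?notin_setE => Ex;
  case: ifPn => //; rewrite ?inE ?notin_setE => Dx.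
- by case: Dx; exact: ED.
- by rewrite f0.
Qed.

Definition real_weak_derivative f g := forall phi, test_function phi ->
  \int[mu]_(x in Rpos) (f x * derive1 phi x) =
  - \int[mu]_(x in Rpos) (g x * phi x).

(** What integration by parts needs. The derivative vanishes off [[a, b]] because [phi] is zero on a
    neighbourhood of each such point, and the fundamental theorem of calculus, with [phi 0 = 0],
    makes [phi] a primitive from 0. *)
Lemma test_functionP phi : test_function phi ->
  [/\ continuous (derive1 phi), continuous phi & exists a b,
    [/\ 0 < a, forall x, x < a -> phi x = 0 /\ derive1 phi x = 0,
      forall x, b < x -> phi x = 0 /\ derive1 phi x = 0 &
      forall x, 0 <= x -> phi x = prim (derive1 phi) x]].
Proof.
move=> [dphi cphi [a [b [a0 s]]]].
have cp : continuous phi.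
  by move=> x; apply: differentiable_continuous; exact/derivable1_diffP.
have z x : (\near x, phi x = 0) -> phi x = 0 /\ derive1 phi x = 0.
  move=> nx; split; first exact: nbhs_singleton nx.
  by rewrite derive1E (@near_eq_derive _ _ _ _ (cst 0)) ?derive_cst.
split=> //; exists a, b; split=> //.
- move=> x xa; apply: z; near=> y; apply: s; apply/negP; rewrite negb_and -ltNge.
  by apply/orP; left; near: y; exact: lt_nbhsl.
- move=> x bx; apply: z; near=> y; apply: s; apply/negP; rewrite negb_and -!ltNge.
  by apply/orP; right; near: y; exact: lt_nbhsr.
have phi0 : phi 0 = 0 by apply: s; apply/negP; rewrite negb_and -ltNge a0.
move=> x; rewrite le_eqVlt => /predU1P[<-|x0]; first by rewrite prim_le0.
have LR : derivable_oo_LRcontinuous phi 0 x.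
  split=> //.
  - by apply: cvg_at_right_filter; exact: cp.
  - by apply: cvg_at_left_filter; exact: cp.
have := @continuous_FTC2 R (derive1 phi) phi 0 x x0 (continuous_subspaceT cphi) LR
  (fun y _ => erefl).
rewrite phi0 -EFinB subr0 EFin_Rintegral//; last exact: continuous_integ.
move=> [<-]; rewrite /prim Rintegral_itv_obnd_cbnd//.
exact: continuous_locint0.
Unshelve. all: by end_near. Qed.

Lemma locint0_measurable f : locint0 f -> measurable_fun Rpos f.
Proof.
move=> lf; rewrite Rpos_bigcup; apply/measurable_fun_bigcup => // n.
exact: integ_measurable (lf _).
Qed.

Lemma locint0_locally_integrable f : locint0 f -> locally_integrable Rpos f.
Proof.
move=> lf; split; [exact: locint0_measurable|exact: interval_open|].
move=> K KR cK.
have [M [_ HM]] := compact_bounded cK.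
have mK : measurable K by exact: compact_measurable.
have := integrable_norm (lf (M + 1)) => /integrableP[mn]; apply: le_lt_trans.
under [leRHS]eq_integral do rewrite /= normr_id.
apply: ge0_subset_integral => //.
move=> x Kx; rewrite /= in_itv/=; have /RposP -> := KR _ Kx.
by rewrite (le_trans (ler_norm x))//; apply: HM => //; rewrite ltrDl.
Qed.

Lemma locally_integrable_itv f a b : 0 < a -> locally_integrable Rpos f ->
  integ `]a, b] f.
Proof.
move=> a0 [mf _ cf].
have sub : `[a, b]%classic `<=` Rpos.
  by move=> x /=; rewrite in_itv/= => /andP[ax _]; apply/RposP; exact: lt_le_trans ax.
have : integ `[a, b] f.
  have mf' : measurable_fun `[a, b] f by exact: (measurable_funS measurable_Rpos sub mf).
  apply/integrableP; split; first exact/measurable_EFinP.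
  by apply: cf => //; exact: segment_compact.
by apply: integS => // x /=; rewrite !in_itv/= => /andP[/ltW -> ->].
Qed.

(** [prim_prod] for [g] and the derivative of [phi]: the term at 0 vanishes with [phi 0], and the
    one at [N] because [N] is taken past the support. *)
Lemma real_weak_derivative_prim c g : locint0 g ->
  real_weak_derivative (fun x => c + prim g x) g.
Proof.
move=> lg phi tphi.
have [cd cphi [a [b [a0 sa sb E]]]] := test_functionP tphi.
pose N := Num.max b 0 + 1.
have N0 : 0 < N by rewrite /N ltr_wpDl// le_max lexx orbT.
have bN : b < N by rewrite /N ltr_pwDr// le_max lexx.
have ld := continuous_locint0 cd.
have NR : `]0, N]%classic `<=` Rpos by apply: subset_Rpos.
have out x : Rpos x -> ~ `]0, N]%classic x -> b < x.
  move=> /RposP x0 /=; rewrite in_itv/= x0/= => /negP; rewrite -ltNge; exact: lt_trans.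
rewrite (Rintegral_support NR); last by move=> x Rx /(out _ Rx)/sb[_ ->]; rewrite mulr0.
rewrite [in RHS](Rintegral_support NR); last first.
  by move=> x Rx /(out _ Rx)/sb[-> _]; rewrite mulr0.
apply/eqP; rewrite -addr_eq0; apply/eqP.
have := prim_prod c 0 N lg ld.
rewrite add0r -E ?(ltW N0)// (sb _ bN).1 !mulr0 subr0 => H.
rewrite -[RHS]H -RintegralD//; last 2 first.
- apply: (@eq_integ _ _ (fun x => derive1 phi x * (c + prim g x))) => //.
    by move=> x _; rewrite mulrC.
  exact: locint0_mul_prim.
- apply: (@eq_integ _ _ (fun x => g x * (0 + prim (derive1 phi) x))) => //.
    by move=> x; rewrite inE/= in_itv/= add0r => /andP[/ltW x0 _]; rewrite -E.
  exact: locint0_mul_prim.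
apply: eq_prim => x /andP[/ltW x0 _]; rewrite add0r -E//; ring.
Qed.

(** The integral of [psi] from [-oo] is differentiable on the whole line and vanishes to the left of
    [a]. To the right of [b] it equals the full integral, which is 0. *)
Lemma test_function_antiderivative psi a b : 0 < a -> continuous psi ->
  (forall x, ~ (a < x <= b) -> psi x = 0) -> \int[mu]_(x in `]a, b]) psi x = 0 ->
  exists2 phi, test_function phi & derive1 phi = psi.
Proof.
move=> a0 cpsi s I0.
have iT : integ setT psi.
  apply: (@integ_support _ `]a, b]) => //.
    by move=> x _ /=; rewrite in_itv/=; exact: s.
  apply: integS (continuous_integ a b cpsi) => //.
  by move=> x /=; rewrite !in_itv/= => /andP[/ltW -> ->].
have iNy u : mu.-integrable `]-oo, u] (EFin \o psi).
  by apply: (@integS _ _ setT).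
pose phi (x : R) := \int[mu]_(t in `]-oo, x]) psi t.
have P x : derivable phi x 1 /\ derive1 phi x = psi x.
  apply: (@continuous_FTC1 R psi -oo%O x (x + 1)) => //.
  - by rewrite ltrDl.
  - exact: ltNyr.
  - exact: cpsi.
have dE : derive1 phi = psi by apply/funext => x; case: (P x).
exists phi => //; split; first by move=> x; case: (P x).
  by rewrite dE.
exists a, b; split=> // x /negP; rewrite negb_and -!ltNge => /orP[xa|bx].
  rewrite /phi (@Rintegral_support _ set0) ?Rintegral_set0//.
  move=> t /=; rewrite in_itv/= => tx _; apply: s; apply/negP; rewrite negb_and -leNgt.
  by rewrite (le_trans tx (ltW xa)).
rewrite /phi (@Rintegral_support _ `]a, b])//.
  by move=> t /=; rewrite !in_itv/= => /andP[_ /le_trans]; apply; exact: ltW.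
by move=> t _ /=; rewrite in_itv/=; exact: s.
Qed.

(* [bump a b n] is a continuous approximation of the indicator of [`]a, b]]. *)
Definition ramp (n : nat) (t : R) := Num.min 1 (Num.max 0 (n%:R * t)).

Definition bump a b n (x : R) := ramp n (x - a) - ramp n (x - b).

Lemma ramp_continuous n : continuous (ramp n).
Proof.
move=> x.
have c1 : {for x, continuous (fun t : R => n%:R * t : R^o)}.
  by apply: cvgMr; exact: cvg_id.
have c0 (k : R) : {for x, continuous (fun _ : R => k : R^o)} by exact: cvg_cst.
exact: continuous_min (c0 1) (continuous_max (c0 0) c1).
Qed.

Lemma bump_continuous a b n : continuous (bump a b n).
Proof.
have H c : continuous (fun x => ramp n (x - c)).
  move=> x; apply: (@continuous_comp _ _ _ (fun x => x - c) (ramp n));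
    last exact: ramp_continuous.
  by apply: cvgB; [exact: cvg_id|exact: cvg_cst].
by move=> x; apply: cvgB; exact: H.
Qed.

Lemma ramp_itv n t : 0 <= ramp n t <= 1.
Proof.
rewrite /ramp /Num.min /Num.max; case: ifPn; case: ifPn; rewrite ?ltxx -?leNgt; lra.
Qed.

Lemma ramp_le0 n t : t <= 0 -> ramp n t = 0.
Proof.
move=> t0; rewrite /ramp (max_idPl _) ?mulr_ge0_le0//.
by apply/min_idPr.
Qed.

Lemma ramp_ge1 n t : 1 <= n%:R * t -> ramp n t = 1.
Proof.
by move=> nt; rewrite /ramp; apply/min_idPl; rewrite le_max nt orbT.
Qed.

(** The ramp that starts at [b] reaches 1 at [b + 1/n], hence by [b + 1]: the supports are bounded
    uniformly in [n]. *)
Lemma bump_out a b n x : a <= b -> (0 < n)%N -> ~ (a < x <= b + 1) -> bump a b n x = 0.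
Proof.
move=> ab n0 /negP; rewrite negb_and -leNgt -ltNge => /orP[xa|bx].
  by rewrite /bump !ramp_le0 ?subrr//; lra.
have n1 : 1 <= n%:R :> R by rewrite ler1n.
by rewrite /bump !ramp_ge1 ?subrr//; nra.
Qed.

Lemma bump_norm a b n x : `|bump a b n x| <= 1.
Proof.
have := ramp_itv n (x - a); have := ramp_itv n (x - b).
by rewrite /bump ler_norml; lra.
Qed.

Lemma ramp_cvg t : \forall n \near \oo, ramp n t = (0 < t)%R%:R.
Proof.
have [t0|t0] := ltP 0 t; last by near=> n; rewrite ramp_le0.
near=> n; apply: ramp_ge1; rewrite -ler_pdivrMr//.
near: n; exact: nbhs_infty_ger.
Unshelve. all: by end_near. Qed.

(** At each point the sequence is eventually constant. A ramp is 0 at its starting point, so the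
    limit excludes [a] and includes [b]. *)
Lemma bump_cvg a b x : a <= b ->
  \forall n \near \oo, bump a b n x = \1_(`]a, b]%classic) x.
Proof.
move=> ab; near=> n; rewrite /bump.
have -> : ramp n (x - a) = (0 < x - a)%R%:R by near: n; exact: ramp_cvg.
have -> : ramp n (x - b) = (0 < x - b)%R%:R by near: n; exact: ramp_cvg.
rewrite indicE !subr_gt0 mem_setE in_itv/=.
case: (ltP a x) => ax /=; case: (ltP b x) => bx //=; rewrite ?subrr ?subr0//; lra.
Unshelve. all: by end_near. Qed.

Lemma bump_integral_cvg D f a b : measurable D -> integ D f -> a <= b ->
  \int[mu]_(x in D) (f x * bump a b n x) @[n --> \oo] -->
  \int[mu]_(x in D) (f x * \1_(`]a, b]%classic) x).
Proof.
move=> mD iD ab.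
have mf := integ_measurable iD.
have mb n : measurable_fun D (fun x => f x * bump a b n x).
  apply: measurable_funM => //.
  by apply: measurable_funS (continuous_measurable_fun (@bump_continuous a b n)).
have m1 : measurable_fun D (fun x => f x * \1_(`]a, b]%classic) x).
  by apply: measurable_funM => //; exact: measurable_indic.
have [|||||[i1 _ cv]] := @dominated_convergence _ _ R mu D mD
  (fun n x => (f x * bump a b n x)%:E) (fun x => (f x * \1_(`]a, b]%classic) x)%:E)
  (fun x => `|f x|%:E).
- by move=> n; apply/measurable_EFinP; exact: mb.
- by apply/measurable_EFinP; exact: m1.
- apply: aeW => x _.
  apply: cvg_near_cst.
  by near=> n; congr (_ * _)%:E; near: n; exact: bump_cvg.
- exact: integrable_norm.
- apply: aeW => x n _ /=; rewrite lee_fin normrM ler_piMr//; exact: bump_norm.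
apply: (@fine_cvg _ _ _ _ _ _ ).
rewrite fineK; last exact: integrable_fin_num.
exact: cv.
Unshelve. all: by end_near. Qed.

Lemma ae_imp (P Q : R -> Prop) : {ae mu, forall x, P x} ->
  (forall x, P x -> Q x) -> {ae mu, forall x, Q x}.
Proof.
by move=> aP PQ; apply: (@negligibleS _ _ _ mu _ _ _ aP) => x /=; apply: contra_not; exact: PQ.
Qed.

Lemma ae_imp2 (P Q S : R -> Prop) : {ae mu, forall x, P x} ->
  {ae mu, forall x, Q x} -> (forall x, P x -> Q x -> S x) -> {ae mu, forall x, S x}.
Proof.
move=> aP aQ PQ; have := @negligibleU _ _ _ mu _ _ aP aQ.
apply: (@negligibleS _ _ _ mu) => x /= nS; apply: contrapT => /not_orP[].
by move=> /contrapT Px /contrapT Qx; apply: nS; exact: PQ.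
Qed.

(** By Lebesgue differentiation: the primitive of [f] cut off to a bounded interval is identically
    0, so its almost everywhere derivative [f] is 0 there. Countably many such intervals cover the
    half-line. *)
Lemma ae_eq0_itv f : (forall a b, 0 < a -> a < b -> integ `]a, b] f) ->
  (forall a b, 0 < a -> a < b -> \int[mu]_(x in `]a, b]) f x = 0) ->
  ae_eq mu Rpos f (cst 0).
Proof.
move=> fi f0.
(* The extra 1 in the right endpoint keeps the interval nondegenerate for [n = 0]. *)
have H (n : nat) : {ae mu, forall x, n.+1%:R^-1 < x <= n.+1%:R + 1 -> f x = 0}.
  pose a : R := n.+1%:R^-1; pose b : R := n.+1%:R + 1.
  have a0 : 0 < a by rewrite invr_gt0.
  have ab : a < b.
    have a1 : a <= 1 by rewrite invf_le1 ?ler1n.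
    have n1 : 1 <= n.+1%:R :> R by rewrite ler1n.
    by rewrite /b; lra.
  pose g := f \_ `]a, b].
  have ig : integ setT g by apply: (integ_restrict _ _).1 => //; exact: fi.
  have ig' y : mu.-integrable [set` Interval -oo%O (BRight y)] (EFin \o g).
    by apply: (@integS _ _ setT).
  have lg : locally_integrable setT g by apply: open_integrable_locally => //; exact: openT.
  have := FTC1 ig' lg; rewrite /=.
  have -> : (fun x : R => \int[mu]_(t in `]-oo, x]) g t) = cst 0.
    apply/funext => y; rewrite /g -Rintegral_mkcondr.
    have [ay|ya] := ltP a y.
      have -> : `]-oo, y] `&` `]a, b] = `]a, Num.min y b]%classic.
        apply/seteqP; split => t /=; rewrite !in_itv/= le_min; last by case/and3P=> -> -> ->.
        by move=> [-> /andP[-> ->]].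
      by rewrite f0// lt_min ay.
    rewrite (_ : _ `&` _ = set0) ?Rintegral_set0// -subset0 => t /=.
    rewrite !in_itv/= => -[ty /andP[at_ _]].
    by have := lt_le_trans at_ (le_trans ty ya); rewrite ltxx.
  move=> /ae_imp; apply => x /(_ (ltNyr _))[_]; rewrite derive1_cst /g patchE => H xab.
  by move: H; rewrite ifT// inE/= in_itv.
have := @ae_foralln _ _ _ mu _ H.
move=> /ae_imp; apply => x /= Hx /RposP x0.
(* This [n] exceeds both [x] and its inverse, which places [x] in the interval of index [n]. *)
pose n := Num.bound (x + x^-1).
have := archi_boundP (_ : 0 <= x + x^-1).
rewrite addr_ge0 ?invr_ge0 ?ltW// => /(_ isT) xn.
have i0 : 0 < x^-1 by rewrite invr_gt0.
have nn : n%:R <= n.+1%:R :> R by rewrite ler_nat.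
rewrite -/n in xn.
apply: (Hx n); rewrite -[X in _ < X <= _]invrK ltf_pV2 ?posrE//; lra.
Qed.

(* Two bumps combined so as to have mean zero form the derivative of a test function. *)
Lemma bump_scalar_test (a b A B : R) f : 0 < A -> A <= a -> A <= 1 -> a <= b ->
  b + 1 <= B -> 3 <= B -> integ `]A, B] f ->
  (forall phi, test_function phi -> \int[mu]_(x in Rpos) (f x * derive1 phi x) = 0) ->
  forall n, (0 < n)%N ->
  \int[mu]_(x in `]A, B]) (f x * bump a b n x) * \int[mu]_(x in `]A, B]) (1 * bump 1 2 n x) =
  \int[mu]_(x in `]A, B]) (f x * bump 1 2 n x) * \int[mu]_(x in `]A, B]) (1 * bump a b n x).
Proof.
move=> A0 Aa A1 ab bB B3 fi H n n0.
set J := \int[mu]_(x in _) (1 * bump 1 2 n x).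
set I := \int[mu]_(x in _) (1 * bump a b n x).
pose psi x := J * bump a b n x - I * bump 1 2 n x.
have cb c d : continuous (bump c d n) by exact: bump_continuous.
have mb c d : measurable_fun `]A, B] (bump c d n).
  by apply: measurable_funS (continuous_measurable_fun (cb c d)).
have ib c d g : integ `]A, B] g -> integ `]A, B] (fun x => g x * bump c d n x).
  by move=> ig; apply: (@integ_mul_bounded _ _ _ _ 1) => // x _; exact: bump_norm.
have i1 : integ `]A, B] (fun=> 1) by exact: integ_itv_cst.
have cpsi : continuous psi.
  by move=> x; apply: cvgB; apply: cvgMr; exact: cb.
have spsi x : ~ (A < x <= B) -> psi x = 0.
  move=> Hx; rewrite /psi !bump_out ?mulr0 ?subrr// ?ler1n ?ler_nat//.
  - by move=> /andP[x1 x2]; apply: Hx; lra.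
  - by move=> /andP[x1 x2]; apply: Hx; lra.
have ipsi : \int[mu]_(x in `]A, B]) psi x = 0.
  have -> : \int[mu]_(x in `]A, B]) psi x =
      \int[mu]_(x in `]A, B]) (J * (1 * bump a b n x) - I * (1 * bump 1 2 n x)).
    by apply: eq_Rintegral => x _; rewrite !mul1r.
  rewrite RintegralB//; last 2 first.
  - by apply: integZ => //; exact: ib.
  - by apply: integZ => //; exact: ib.
  by rewrite (RintegralZ J)// 1?(RintegralZ I)//; try exact: ib; rewrite -/I -/J mulrC subrr.
have [phi tphi dphi] := test_function_antiderivative A0 cpsi spsi ipsi.
have := H _ tphi; rewrite dphi.
rewrite (@Rintegral_support _ `]A, B]); last 2 first.
- by apply: subset_Rpos; exact: ltW.
- by move=> x _ /=; rewrite in_itv/= => /spsi ->; rewrite mulr0.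
have -> : \int[mu]_(x in `]A, B]) (f x * psi x) =
    \int[mu]_(x in `]A, B]) (J * (f x * bump a b n x) - I * (f x * bump 1 2 n x)).
  by apply: eq_Rintegral => x _; rewrite /psi; ring.
rewrite RintegralB//; last 2 first.
- by apply: integZ => //; exact: ib.
- by apply: integZ => //; exact: ib.
rewrite !RintegralZ//; try exact: ib.
by move=> /eqP; rewrite subr_eq0 => /eqP; rewrite mulrC => ->; rewrite mulrC.
Qed.

Let cvgM_nat (u v : nat -> R) (l m : R) : u n @[n --> \oo] --> l ->
  v n @[n --> \oo] --> m -> u n * v n @[n --> \oo] --> l * m.
Proof. by move=> ul vm; exact: cvgM. Qed.

(** The lemma of du Bois-Reymond. Letting the bumps converge to indicators shows that the mean of
    [f] over any []a, b]] equals its mean [c] over the reference interval []1, 2]], of length 1.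
    Hence [f - c] has zero integral over every interval. *)
Lemma test_orthogonal_constant f : locally_integrable Rpos f ->
  (forall phi, test_function phi -> \int[mu]_(x in Rpos) (f x * derive1 phi x) = 0) ->
  exists c, ae_eq mu Rpos f (cst c).
Proof.
move=> lf H.
pose c := \int[mu]_(x in `]1, 2]) f x.
have fi a b : 0 < a -> integ `]a, b] f by move=> a0; exact: locally_integrable_itv.
have E a b : 0 < a -> a < b -> \int[mu]_(x in `]a, b]) f x = c * (b - a).
  move=> a0 ab.
  (* A common interval for the supports of both bumps, which lie in []a, b + 1]] and []1, 3]]. *)
  pose A := Num.min a 1; pose B := Num.max (b + 1) 3.
  have A0 : 0 < A by rewrite /A lt_min a0/=.
  have Aa : A <= a by rewrite /A ge_min lexx.
  have A1 : A <= 1 by rewrite /A ge_min lexx orbT.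
  have bB : b + 1 <= B by rewrite /B le_max lexx.
  have B3 : 3 <= B by rewrite /B le_max lexx orbT.
  have fAB := fi A B A0.
  have i1 : integ `]A, B] (fun=> 1) by exact: integ_itv_cst.
  have S g p r : A <= p -> r <= B ->
      \int[mu]_(x in `]A, B]) (g x * \1_(`]p, r]%classic) x) =
      \int[mu]_(x in `]p, r]) g x.
    move=> Ap rB; rewrite (@Rintegral_support _ `]p, r]).
    - by apply: eq_Rintegral => x xp; rewrite indicE xp mulr1.
    - by move=> x /=; rewrite !in_itv/=; lra.
    - by move=> x _ xp; rewrite indicE memNset ?mulr0.
  have cst1 p r : p <= r -> \int[mu]_(x in `]p, r]) 1 = r - p.
    move=> pr; rewrite Rintegral_cst//= lebesgue_measure_itv/= lte_fin mul1r.
    by case: ltP => //= rp; apply/esym/eqP; rewrite subr_eq0 eq_le pr rp.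
  have l1 : (1 : R) <= 2 by lra.
  have L1 := cvgM_nat (bump_integral_cvg (measurable_itv _) fAB (ltW ab))
    (bump_integral_cvg (measurable_itv _) i1 l1).
  have L2 := cvgM_nat (bump_integral_cvg (measurable_itv _) fAB l1)
    (bump_integral_cvg (measurable_itv _) i1 (ltW ab)).
  have bB' : b <= B by lra.
  have B2 : 2 <= B by lra.
  rewrite !S// !cst1 ?(ltW ab)// in L1 L2.
  have L12 : \int[mu]_(x in `]a, b]) f x * (2 - 1) = \int[mu]_(x in `]1, 2]) f x * (b - a).
    apply: (cvg_unique _ L1) => //.
    apply: cvg_trans L2; apply: near_eq_cvg; near=> n.
    rewrite /=; apply/esym; apply: bump_scalar_test => //; first exact: ltW.
    by near: n; exact: nbhs_infty_gt.
  by rewrite /c -L12; ring.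
exists c.
have : ae_eq mu Rpos (fun x => f x - c) (cst 0).
  apply: ae_eq0_itv => a b a0 ab.
    by apply: integB => //; [exact: fi|exact: integ_itv_cst].
  rewrite RintegralB//; [|exact: fi|exact: integ_itv_cst].
  rewrite E// Rintegral_cst//= lebesgue_measure_itv/= lte_fin ab/=; ring.
by move=> /ae_imp; apply => x /= Hx /Hx/eqP; rewrite subr_eq0 => /eqP.
Unshelve. all: by end_near. Qed.

(** The difference [f - prim g] has weak derivative 0, so it is almost everywhere constant. *)
Lemma real_weak_derivative_ae_prim f g : locally_integrable Rpos f -> locint0 g ->
  real_weak_derivative f g ->
  exists c, ae_eq mu Rpos f (fun x => c + prim g x).
Proof.
move=> lf lg fg.
have lp : locint0 (prim g).
  move=> N; apply: (@eq_integ _ _ (fun x => 0 + prim g x)) => //.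
    by move=> x _; rewrite add0r.
  exact: locint0_prim.
have Lp := locint0_locally_integrable lp.
have [||c Hc] := @test_orthogonal_constant (fun x => f x - prim g x).
- exact: locally_integrableB.
- move=> phi tphi.
  have [cd cphi [a [b [a0 sa sb E]]]] := test_functionP tphi.
  (* With left endpoint [a / 2] the complement lies strictly left of [a] or strictly right of [b],
     where the derivative is known to vanish. *)
  have out x : Rpos x -> ~ `]a / 2, b]%classic x -> derive1 phi x = 0.
    move=> /RposP x0 /= /negP; rewrite in_itv/= negb_and -leNgt -ltNge => /orP[xa|/sb[]//].
    by apply: (sa x _).2; lra.
  have sub : `]a / 2, b]%classic `<=` Rpos by apply: subset_Rpos; lra.
  have i h : locally_integrable Rpos h -> integ Rpos (fun x => h x * derive1 phi x).
    move=> lh; apply: (@integ_support _ `]a / 2, b]) => //.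
      by move=> x Rx nx; rewrite out ?mulr0.
    have [M [_ HM]] : bounded_set (derive1 phi @` `[a / 2, b]).
      apply: compact_bounded; apply: continuous_compact; last exact: segment_compact.
      exact: continuous_subspaceT.
    apply: (@integ_mul_bounded _ _ _ _ (M + 1)) => //.
    - by apply: locally_integrable_itv => //; lra.
    - by apply: measurable_funS (continuous_measurable_fun cd).
    - move=> x /=; rewrite in_itv/= => /andP[/ltW ax xb].
      apply: (HM (M + 1)); first by rewrite ltrDl.
      by exists x => //=; rewrite in_itv/= ax.
  have -> : \int[mu]_(x in Rpos) ((f x - prim g x) * derive1 phi x) =
    \int[mu]_(x in Rpos) (f x * derive1 phi x - prim g x * derive1 phi x).
    by apply: eq_Rintegral => x _; rewrite mulrBl.
  have if1 := i _ lf; have ip1 := i _ Lp.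
  rewrite RintegralB//; last exact: measurable_Rpos.
  rewrite fg//; have := real_weak_derivative_prim 0 lg tphi.
  under eq_Rintegral do rewrite add0r.
  by move=> ->; rewrite subrr.
exists c; apply: (ae_imp Hc) => x /= H /H/eqP.
by rewrite subr_eq => /eqP.
Qed.

End Weak.

(** * Complex-valued functions *)

Section Complex.
Context {R : realType}.
Local Notation mu := (@lebesgue_measure R).
Local Notation C := R[i].
Local Notation Re := (@complex.Re R).
Local Notation Im := (@complex.Im R).
Implicit Types (f g h u v : R -> C) (D : set R) (c d k z w : C) (x N : R).

Local Hint Resolve measurable_Rpos : core.

Lemma complex_ext z w : Re z = Re w -> Im z = Im w -> z = w.
Proof. by case: z w => [a b] [a' b'] /= -> ->. Qed.

Lemma Re_add z w : Re (z + w) = Re z + Re w. Proof. by case: z w => [? ?] [? ?]. Qed.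
Lemma Im_add z w : Im (z + w) = Im z + Im w. Proof. by case: z w => [? ?] [? ?]. Qed.
Lemma Re_opp z : Re (- z) = - Re z. Proof. by case: z. Qed.
Lemma Im_opp z : Im (- z) = - Im z. Proof. by case: z. Qed.
Lemma Re_mul z w : Re (z * w) = Re z * Re w - Im z * Im w.
Proof. by case: z w => [? ?] [? ?]. Qed.
Lemma Im_mul z w : Im (z * w) = Re z * Im w + Im z * Re w.
Proof. by case: z w => [? ?] [? ?]. Qed.
Lemma Re_conj z : Re z^* = Re z. Proof. by case: z. Qed.
Lemma Im_conj z : Im z^* = - Im z. Proof. by case: z. Qed.

Lemma Re_mul_real z (r : R) : Re (z * r%:C) = Re z * r.
Proof. by rewrite Re_mul /= mulr0 subr0. Qed.
Lemma Im_mul_real z (r : R) : Im (z * r%:C) = Im z * r.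
Proof. by rewrite Im_mul /= mulr0 add0r. Qed.

Definition reimE := (Re_add, Im_add, Re_opp, Im_opp, Re_mul, Im_mul, Re_conj, Im_conj).

Definition Cinteg D f := integ D (fun x => Re (f x)) /\ integ D (fun x => Im (f x)).

Definition Cint D f : C := (\int[mu]_(x in D) Re (f x)) +i* (\int[mu]_(x in D) Im (f x)).

Lemma eq_Cinteg D f g : measurable D -> {in D, f =1 g} -> Cinteg D f -> Cinteg D g.
Proof.
by move=> mD fg [fr fi]; split; [apply: eq_integ fr|apply: eq_integ fi] => // x xD; rewrite fg.
Qed.

Lemma eq_Cint D f g : {in D, f =1 g} -> Cint D f = Cint D g.
Proof. by move=> fg; apply: complex_ext; apply: eq_Rintegral => x xD; rewrite fg. Qed.

Lemma CintegD D f g : measurable D -> Cinteg D f -> Cinteg D g ->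
  Cinteg D (fun x => f x + g x).
Proof.
move=> mD [fr fi] [gr gi]; split.
- by apply: (eq_integ _ _ (integD mD fr gr)) => // x _; rewrite reimE.
- by apply: (eq_integ _ _ (integD mD fi gi)) => // x _; rewrite reimE.
Qed.

Lemma CintegZ D k f : measurable D -> Cinteg D f -> Cinteg D (fun x => k * f x).
Proof.
move=> mD [fr fi]; split.
- apply: (eq_integ _ _ (integB mD (integZ (Re k) mD fr) (integZ (Im k) mD fi))) => // x _.
  by rewrite reimE.
- apply: (eq_integ _ _ (integD mD (integZ (Re k) mD fi) (integZ (Im k) mD fr))) => // x _.
  by rewrite reimE.
Qed.

Lemma CintegN D f : measurable D -> Cinteg D f -> Cinteg D (fun x => - f x).
Proof.
move=> mD /(CintegZ (- 1) mD); apply: eq_Cinteg => // x _; exact: mulN1r.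
Qed.

Lemma CintegB D f g : measurable D -> Cinteg D f -> Cinteg D g ->
  Cinteg D (fun x => f x - g x).
Proof. by move=> mD If Ig; apply: CintegD => //; exact: CintegN. Qed.

Lemma CintegS D E f : measurable D -> measurable E -> D `<=` E -> Cinteg E f -> Cinteg D f.
Proof. by move=> mD mE DE [fr fi]; split; [exact: integS fr|exact: integS fi]. Qed.

Lemma CintD D f g : measurable D -> Cinteg D f -> Cinteg D g ->
  Cint D (fun x => f x + g x) = Cint D f + Cint D g.
Proof.
move=> mD [fr fi] [gr gi]; apply: complex_ext; rewrite reimE /= -RintegralD//.
- by apply: eq_Rintegral => x _; rewrite reimE.
- by apply: eq_Rintegral => x _; rewrite reimE.
Qed.

Lemma CintZ D k f : measurable D -> Cinteg D f -> Cint D (fun x => k * f x) = k * Cint D f.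
Proof.
move=> mD [fr fi]; apply: complex_ext; rewrite reimE /= -!RintegralZ//.
- rewrite -RintegralB//; [|exact: integZ..].
  by apply: eq_Rintegral => x _; rewrite reimE.
- rewrite -RintegralD//; [|exact: integZ..].
  by apply: eq_Rintegral => x _; rewrite reimE.
Qed.

Lemma CintN D f : measurable D -> Cinteg D f -> Cint D (fun x => - f x) = - Cint D f.
Proof.
by move=> mD If; rewrite -mulN1r -CintZ//; apply: eq_Cint => x _; rewrite mulN1r.
Qed.

Lemma CintB D f g : measurable D -> Cinteg D f -> Cinteg D g ->
  Cint D (fun x => f x - g x) = Cint D f - Cint D g.
Proof.
by move=> mD If Ig; rewrite CintD ?CintN//; exact: CintegN.
Qed.

Definition Clocint0 f := forall N, Cinteg `]0, N] f.

Lemma Clocint0P f : Clocint0 f <->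
  locint0 (fun x => Re (f x)) /\ locint0 (fun x => Im (f x)).
Proof. by split=> [H|[H1 H2] N]; split=> //; move=> N; case: (H N). Qed.

Definition cprim f x : C := Cint `]0, x] f.

Lemma Re_cprim f x : Re (cprim f x) = prim (fun t => Re (f t)) x.
Proof. by []. Qed.

Lemma Im_cprim f x : Im (cprim f x) = prim (fun t => Im (f t)) x.
Proof. by []. Qed.

Lemma cprim_le0 f x : x <= 0 -> cprim f x = 0.
Proof. by move=> x0; apply: complex_ext; exact: prim_le0. Qed.

Lemma cprimD f g x : Clocint0 f -> Clocint0 g ->
  cprim (fun t => f t + g t) x = cprim f x + cprim g x.
Proof. by move=> lf lg; rewrite /cprim CintD. Qed.

Lemma cprimB f g x : Clocint0 f -> Clocint0 g ->
  cprim (fun t => f t - g t) x = cprim f x - cprim g x.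
Proof. by move=> lf lg; rewrite /cprim CintB. Qed.

Lemma Clocint0D f g : Clocint0 f -> Clocint0 g -> Clocint0 (fun x => f x + g x).
Proof. by move=> lf lg N; exact: CintegD. Qed.

Lemma Clocint0_cst k : Clocint0 (cst k).
Proof. by move=> N; split; exact: integ_itv_cst. Qed.

Lemma Clocint0_mul_prim f g d : Clocint0 f -> Clocint0 g ->
  Clocint0 (fun x => f x * (d + cprim g x)).
Proof.
move=> /Clocint0P[fr fi] /Clocint0P[gr gi]; apply/Clocint0P; split.
- have := locint0B (locint0_mul_prim (Re d) fr gr) (locint0_mul_prim (Im d) fi gi).
  by move=> H N; apply: (eq_integ _ _ (H N)) => // x _; rewrite !reimE.
- have := locint0D (locint0_mul_prim (Im d) fr gi) (locint0_mul_prim (Re d) fi gr).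
  by move=> H N; apply: (eq_integ _ _ (H N)) => // x _; rewrite !reimE.
Qed.

Lemma Clocint0_prim c g : Clocint0 g -> Clocint0 (fun x => c + cprim g x).
Proof.
move=> lg N; apply: (eq_Cinteg _ _ (Clocint0_mul_prim c (Clocint0_cst 1) lg N)) => //.
by move=> x _; rewrite mul1r.
Qed.

Lemma cprim_prod c d f g N : Clocint0 f -> Clocint0 g ->
  cprim (fun x => f x * (d + cprim g x) + g x * (c + cprim f x)) N =
  (c + cprim f N) * (d + cprim g N) - c * d.
Proof.
move=> /Clocint0P[fr fi] /Clocint0P[gr gi].
have P (f1 g1 : R -> R) (c1 d1 : R) := @prim_prod R c1 d1 f1 g1 N.
have L (a b : R) (f1 g1 : R -> R) : locint0 f1 -> locint0 g1 ->
   locint0 (fun x => f1 x * (b + prim g1 x) + g1 x * (a + prim f1 x)).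
  by move=> lf lg; apply: locint0D; exact: locint0_mul_prim.
apply: complex_ext.
- have E := P _ _ (Re c) (Re d) fr gr; have F := P _ _ (Im c) (Im d) fi gi.
  transitivity (
    ((Re c + prim (fun x => Re (f x)) N) * (Re d + prim (fun x => Re (g x)) N)
     - Re c * Re d) -
    ((Im c + prim (fun x => Im (f x)) N) * (Im d + prim (fun x => Im (g x)) N)
     - Im c * Im d)).
    rewrite -E -F -primB; [|exact: L..].
    apply: eq_prim => t _; rewrite !reimE !Re_cprim !Im_cprim; ring.
  rewrite !reimE !Re_cprim !Im_cprim; ring.
- have E := P _ _ (Re c) (Im d) fr gi; have F := P _ _ (Im c) (Re d) fi gr.
  transitivity (
    ((Re c + prim (fun x => Re (f x)) N) * (Im d + prim (fun x => Im (g x)) N)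
     - Re c * Im d) +
    ((Im c + prim (fun x => Im (f x)) N) * (Re d + prim (fun x => Re (g x)) N)
     - Im c * Re d)).
    rewrite -E -F -primD; [|exact: L..].
    apply: eq_prim => t _; rewrite !reimE !Re_cprim !Im_cprim; ring.
  rewrite !reimE !Re_cprim !Im_cprim; ring.
Qed.

(* [sol0 c0 c1 h] is the [u] such that [u'' = h], [u 0 = c0] and [u' 0 = c1], and
   [sol1 c1 h] is [u']. *)
Definition sol1 c1 h x := c1 + cprim h x.
Definition sol0 c0 c1 h x := c0 + cprim (sol1 c1 h) x.

Lemma Clocint0_sol1 c h : Clocint0 h -> Clocint0 (sol1 c h).
Proof. exact: Clocint0_prim. Qed.

Lemma Clocint0_sol0_mul f c0 c1 h : Clocint0 f -> Clocint0 h ->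
  Clocint0 (fun x => f x * sol0 c0 c1 h x).
Proof. by move=> lf lh; apply: Clocint0_mul_prim => //; exact: Clocint0_sol1. Qed.

(** The Wronskian [u v' - u' v] has derivative [u v'' - u'' v]. Here this is two instances of the
    product rule, in whose difference the terms [u' v'] cancel. *)
Lemma Lagrange_identity a0 a1 f b0 b1 g x : Clocint0 f -> Clocint0 g ->
  sol0 a0 a1 f x * sol1 b1 g x - sol1 a1 f x * sol0 b0 b1 g x =
  (a0 * b1 - a1 * b0) +
  cprim (fun t => g t * sol0 a0 a1 f t - f t * sol0 b0 b1 g t) x.
Proof.
move=> lf lg.
have lU1 := Clocint0_sol1 a1 lf; have lV1 := Clocint0_sol1 b1 lg.
have E1 := cprim_prod a0 b1 x lU1 lg; have E2 := cprim_prod b0 a1 x lV1 lf.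
transitivity ((a0 * b1 - a1 * b0) +
  ((sol0 a0 a1 f x * sol1 b1 g x - a0 * b1) - (sol0 b0 b1 g x * sol1 a1 f x - b0 * a1))).
  by ring.
rewrite -E1 -E2 -cprimB; last 2 first.
- by apply: Clocint0D; [exact: Clocint0_mul_prim|exact: Clocint0_sol0_mul].
- by apply: Clocint0D; [exact: Clocint0_mul_prim|exact: Clocint0_sol0_mul].
congr (_ + _); apply: eq_Cint => t _.
rewrite /sol0 /sol1; ring.
Qed.

Lemma Cint_derivative_Rpos c g : Cinteg Rpos (fun x => c + cprim g x) -> Cinteg Rpos g ->
  Cint Rpos g = - c.
Proof.
move=> [wr wi] [gr gi]; apply: complex_ext; rewrite reimE /=.
- by apply: integral_derivative_Rpos gr; apply: (eq_integ _ _ wr) => // x _; rewrite reimE.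
- by apply: integral_derivative_Rpos gi; apply: (eq_integ _ _ wi) => // x _; rewrite reimE.
Qed.

(** * Square-integrable complex functions *)

Lemma L2P f : L2 f <-> L2r (fun x => Re (f x)) /\ L2r (fun x => Im (f x)).
Proof.
split=> [[mr mi fy]|[[mr ir] [mi ii]]].
  have i2 : integ Rpos (fun x => normsq (f x)).
    apply/integrableP; split.
      by apply/measurable_EFinP; apply: measurable_funD; exact: measurable_funX.
    apply: le_lt_trans fy; rewrite le_eqVlt; apply/orP; left; apply/eqP.
    apply: eq_integral => x _; rewrite /= ger0_norm//.
    by rewrite /normsq addr_ge0 ?sqr_ge0.
  split; split=> //.
  - apply: (le_integ _ _ _ i2) => //; first exact: measurable_funX.
    by move=> x _; rewrite ger0_norm ?sqr_ge0// /normsq lerDl sqr_ge0.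
  - apply: (le_integ _ _ _ i2) => //; first exact: measurable_funX.
    by move=> x _; rewrite ger0_norm ?sqr_ge0// /normsq lerDr sqr_ge0.
split=> //; rewrite /L2normsq.
have i2 : integ Rpos (fun x => normsq (f x)) by exact: integD.
by rewrite EFin_Rintegral// ltry.
Qed.

Lemma L2_normsq_integ f : L2 f -> integ Rpos (fun x => normsq (f x)).
Proof. by move=> /L2P[[_ fr] [_ fi]]; exact: integD. Qed.

Lemma L2D f g : L2 f -> L2 g -> L2 (fun x => f x + g x).
Proof.
move=> /L2P[fr fi] /L2P[gr gi]; apply/L2P; split.
- under eq_fun do rewrite reimE; exact: L2rD.
- under eq_fun do rewrite reimE; exact: L2rD.
Qed.

Lemma L2r_B (f g : R -> R) : L2r f -> L2r g -> L2r (fun x => f x - g x).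
Proof.
move=> Lf Lg; have := L2rD Lf (L2rZ (-1) Lg).
by under eq_fun do rewrite mulN1r.
Qed.

Lemma L2Z k f : L2 f -> L2 (fun x => k * f x).
Proof.
move=> /L2P[fr fi]; apply/L2P; split.
- under eq_fun do rewrite reimE; apply: L2r_B; exact: L2rZ.
- under eq_fun do rewrite reimE; apply: L2rD; exact: L2rZ.
Qed.

Lemma L2N f : L2 f -> L2 (fun x => - f x).
Proof. by move=> /(L2Z (- 1)); under eq_fun do rewrite mulN1r. Qed.

Lemma L2B f g : L2 f -> L2 g -> L2 (fun x => f x - g x).
Proof. by move=> Lf Lg; apply: L2D => //; exact: L2N. Qed.

Lemma L2J f : L2 f -> L2 (fun x => (f x)^*).
Proof.
move=> /L2P[fr fi]; apply/L2P; split.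
- by under eq_fun do rewrite reimE.
- under eq_fun do rewrite reimE; have := L2rZ (-1) fi.
  by under eq_fun do rewrite mulN1r.
Qed.

Lemma L2_mul_integ f g : L2 f -> L2 g -> Cinteg Rpos (fun x => f x * g x).
Proof.
move=> /L2P[fr fi] /L2P[gr gi]; split.
- apply: (eq_integ _ _ (integB measurable_Rpos (L2r_mul fr gr) (L2r_mul fi gi))) => // x _.
  by rewrite reimE.
- apply: (eq_integ _ _ (integD measurable_Rpos (L2r_mul fr gi) (L2r_mul fi gr))) => // x _.
  by rewrite reimE.
Qed.

Lemma L2_locint0 f : L2 f -> Clocint0 f.
Proof. by move=> /L2P[fr fi]; apply/Clocint0P; split; exact: L2r_locint0. Qed.

Definition bounded_measurable (q : R -> C) := exists M : R,
  [/\ measurable_fun Rpos (fun x => Re (q x)), measurable_fun Rpos (fun x => Im (q x)) &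
      forall x, 0 < x -> `|Re (q x)| <= M /\ `|Im (q x)| <= M].

Lemma L2_bounded_mul q f : bounded_measurable q -> L2 f -> L2 (fun x => q x * f x).
Proof.
move=> [M [mr mi qM]] /L2P[fr fi]; apply/L2P.
have qr x : 0 < x -> `|Re (q x)| <= M by move=> /qM[].
have qi x : 0 < x -> `|Im (q x)| <= M by move=> /qM[].
split.
- under eq_fun do rewrite reimE.
  by apply: L2r_B; [apply: (L2r_bounded_mul mr qr)|apply: (L2r_bounded_mul mi qi)].
- under eq_fun do rewrite reimE.
  by apply: L2rD; [apply: (L2r_bounded_mul mr qr)|apply: (L2r_bounded_mul mi qi)].
Qed.

Lemma L2_interpolation c0 c1 h : L2 (sol0 c0 c1 h) -> L2 h -> L2 (sol1 c1 h).
Proof.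
move=> /L2P[ur ui] /L2P[hr hi]; apply/L2P; split.
- have E1 : (fun x => Re (sol1 c1 h x)) = (fun x => Re c1 + prim (fun t => Re (h t)) x).
    by apply/funext => x; rewrite /sol1 reimE.
  have E0 : (fun x => Re (sol0 c0 c1 h x)) =
      (fun x => Re c0 + prim (fun t => Re (sol1 c1 h t)) x).
    by apply/funext => x; rewrite /sol0 reimE.
  by rewrite E1; rewrite E0 E1 in ur; exact: L2r_interpolation ur hr.
- have E1 : (fun x => Im (sol1 c1 h x)) = (fun x => Im c1 + prim (fun t => Im (h t)) x).
    by apply/funext => x; rewrite /sol1 reimE.
  have E0 : (fun x => Im (sol0 c0 c1 h x)) =
      (fun x => Im c0 + prim (fun t => Im (sol1 c1 h t)) x).
    by apply/funext => x; rewrite /sol0 reimE.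
  by rewrite E1; rewrite E0 E1 in ui; exact: L2r_interpolation ui hi.
Qed.

End Complex.

(** * The domain of the Schrodinger operator *)

Section Operator.
Context {R : realType}.
Local Notation mu := (@lebesgue_measure R).
Local Notation C := R[i].
Local Notation Re := (@complex.Re R).
Local Notation Im := (@complex.Im R).
Implicit Types (f g h u v : R -> C) (D : set R) (c d k z w : C) (x N : R).

Local Hint Resolve measurable_Rpos : core.

Lemma itv_not_negligible (P : R -> Prop) (a b : R) : {ae mu, forall x, P x} -> a < b ->
  exists2 x, a < x < b & P x.
Proof.
move=> aP ab; apply: contrapT => H.
have neg : mu.-negligible `]a, b[%classic.
  apply: negligibleS aP => x /=; rewrite in_itv/= => xab Px.
  by apply: H; exists x.
have : mu `]a, b[%classic = 0%E by apply: (@measure_negligible _ _ _ mu) neg.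
rewrite lebesgue_measure_itv/= lte_fin ab -EFinD => -[] /eqP.
by rewrite subr_eq0 => /eqP E; rewrite E ltxx in ab.
Qed.

Lemma eqL2_sym f g : eqL2 f g -> eqL2 g f.
Proof. by move=> /ae_imp; apply => x H /H. Qed.

Lemma eqL2_trans f g h : eqL2 f g -> eqL2 g h -> eqL2 f h.
Proof. by move=> fg gh; apply: (ae_imp2 fg gh) => x H K Rx; rewrite H ?K. Qed.

Lemma Cint_ae f g :
  measurable_fun Rpos (fun x => Re (f x)) -> measurable_fun Rpos (fun x => Im (f x)) ->
  measurable_fun Rpos (fun x => Re (g x)) -> measurable_fun Rpos (fun x => Im (g x)) ->
  eqL2 f g -> Cint Rpos f = Cint Rpos g.
Proof.
move=> fr fi gr gi fg.
apply: complex_ext; rewrite /= /Rintegral; congr fine; apply: ae_eq_integral => //.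
- exact: measurable_Rpos.
- exact/measurable_EFinP.
- exact/measurable_EFinP.
- by apply: (ae_imp fg) => x H /H ->.
- exact: measurable_Rpos.
- exact/measurable_EFinP.
- exact/measurable_EFinP.
- by apply: (ae_imp fg) => x H /H ->.
Qed.

Lemma normsq_measurable f : measurable_fun Rpos (fun x => Re (f x)) ->
  measurable_fun Rpos (fun x => Im (f x)) -> measurable_fun Rpos (fun x => normsq (f x)).
Proof. by move=> fr fi; apply: measurable_funD; exact: measurable_funX. Qed.

Lemma L2_ae f g :
  measurable_fun Rpos (fun x => Re (f x)) -> measurable_fun Rpos (fun x => Im (f x)) ->
  L2 g -> eqL2 f g -> L2 f.
Proof.
move=> fr fi [gr gi gy] fg; split=> //; apply: le_lt_trans gy; rewrite le_eqVlt.
apply/orP; left; apply/eqP; apply: ae_eq_integral => //.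
- exact: measurable_Rpos.
- by apply/measurable_EFinP; exact: normsq_measurable.
- by apply/measurable_EFinP; exact: normsq_measurable.
- by apply: (ae_imp fg) => x H /H ->.
Qed.

Lemma Clocint0_locally_integrable f : Clocint0 f -> Clocally_integrable f.
Proof. by move=> /Clocint0P[fr fi]; split; exact: locint0_locally_integrable. Qed.

Lemma weak_derivativeP f g : weak_derivative f g <->
  [/\ Clocally_integrable f, Clocally_integrable g,
    real_weak_derivative (fun x => Re (f x)) (fun x => Re (g x)) &
    real_weak_derivative (fun x => Im (f x)) (fun x => Im (g x))].
Proof.
have Er h (r : R -> R) : Re (Cintegral (fun x => h x * (r x)%:C)) =
    \int[mu]_(x in Rpos) (Re (h x) * r x).
  by apply: eq_Rintegral => x _; rewrite Re_mul_real.
have Ei h (r : R -> R) : Im (Cintegral (fun x => h x * (r x)%:C)) =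
    \int[mu]_(x in Rpos) (Im (h x) * r x).
  by apply: eq_Rintegral => x _; rewrite Im_mul_real.
split=> [[lf lg H]|[lf lg Hr Hi]]; split=> //.
- by move=> phi /H/(congr1 Re); rewrite Re_opp !Er.
- by move=> phi /H/(congr1 Im); rewrite Im_opp !Ei.
- move=> phi tphi; apply: complex_ext.
  + by rewrite Re_opp !Er; exact: Hr.
  + by rewrite Im_opp !Ei; exact: Hi.
Qed.

Lemma weak_derivative_prim f g : weak_derivative f g -> Clocint0 g ->
  exists c, eqL2 f (sol1 c g).
Proof.
move=> /weak_derivativeP[[fr fi] lg wr wi] /Clocint0P[gr gi].
have [a Ha] := real_weak_derivative_ae_prim fr gr wr.
have [b Hb] := real_weak_derivative_ae_prim fi gi wi.
exists (a +i* b); apply: (ae_imp2 Ha Hb) => x H K Rx; apply: complex_ext.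
- by rewrite H// /sol1 reimE.
- by rewrite K// /sol1 reimE.
Qed.

Lemma weak_derivative_sol1 c g : Clocint0 g -> weak_derivative (sol1 c g) g.
Proof.
move=> lg; apply/weak_derivativeP; split.
- by apply: Clocint0_locally_integrable; exact: Clocint0_sol1.
- exact: Clocint0_locally_integrable.
- move=> phi tphi; have /Clocint0P[gr gi] := lg.
  rewrite -(real_weak_derivative_prim (Re c) gr tphi).
  by apply: eq_Rintegral => x _; rewrite /sol1 reimE.
- move=> phi tphi; have /Clocint0P[gr gi] := lg.
  rewrite -(real_weak_derivative_prim (Im c) gi tphi).
  by apply: eq_Rintegral => x _; rewrite /sol1 reimE.
Qed.

Lemma weak_derivative_ae f h g : weak_derivative h g -> eqL2 f h -> L2 f ->
  weak_derivative f g.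
Proof.
move=> [[hr hi] lg H] fh Lf; have [fr fi _] := Lf; split=> //.
  by apply: Clocint0_locally_integrable; exact: L2_locint0.
move=> phi tphi; rewrite -H//.
have [cd _ _] := test_functionP tphi.
have md : measurable_fun Rpos (derive1 phi).
  by apply: measurable_funS (continuous_measurable_fun cd).
have [mhr _ _] := hr; have [mhi _ _] := hi.
apply: Cint_ae.
- by under eq_fun do rewrite Re_mul_real; exact: measurable_funM.
- by under eq_fun do rewrite Im_mul_real; exact: measurable_funM.
- by under eq_fun do rewrite Re_mul_real; exact: measurable_funM.
- by under eq_fun do rewrite Im_mul_real; exact: measurable_funM.
- by apply: (ae_imp fh) => x E /E ->.
Qed.

(** Makes the boundary value depend on the class only: a nonzero difference at 0 would persist on
    some interval []0, e[], which is not negligible. *)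
Lemma continuous_eq_at0 (F G : R -> R) : continuous F ->
  {within Rnneg, continuous G} -> ae_eq mu Rpos G F -> G 0 = F 0.
Proof.
move=> cF /continuous_within_itvcyP[_ cG] GF.
apply/eqP; rewrite -subr_eq0; apply/negP => /negP ne.
have cF0 : F x @[x --> 0^'+] --> F 0 by apply: cvg_at_right_filter; exact: cF.
have cGF : (G x - F x : R^o) @[x --> 0^'+] --> (G 0 - F 0 : R^o) by exact: cvgB.
have : \forall t \near 0^'+, G t - F t != 0 by apply: cvgr_neq0 cGF ne.
move=> /nbhs_ballP[e /= e0 He].
have [x /andP[x0 xe] Hx] := itv_not_negligible GF e0.
have := He x; rewrite /ball/= sub0r normrN gtr0_norm// => /(_ xe x0).
by rewrite Hx ?subrr ?eqxx//; apply/RposP.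
Qed.

Lemma sol1_continuous c g : Clocint0 g ->
  continuous (fun x => Re (sol1 c g x)) /\ continuous (fun x => Im (sol1 c g x)).
Proof.
move=> /Clocint0P[gr gi]; split.
- under eq_fun do rewrite reimE.
  by move=> x; apply: cvgD; [exact: cvg_cst|exact: prim_continuous].
- under eq_fun do rewrite reimE.
  by move=> x; apply: cvgD; [exact: cvg_cst|exact: prim_continuous].
Qed.

Lemma sol1_at0 c g : sol1 c g 0 = c.
Proof. by rewrite /sol1 cprim_le0 ?addr0. Qed.

Definition bc (alpha : option C) c0 c1 :=
  if alpha is Some a then c1 + a * c0 = 0 else c0 = 0.

(** Any continuous representatives take the values [c0] and [c1] at 0 by [continuous_eq_at0];
    conversely [sol0] and [sol1] are such representatives. *)
Lemma boundary_conditionP alpha f f1 c0 c1 h : Clocint0 h ->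
  eqL2 f (sol0 c0 c1 h) -> eqL2 f1 (sol1 c1 h) ->
  boundary_condition alpha f f1 <-> bc alpha c0 c1.
Proof.
move=> lh E0 E1.
have [s1r s1i] := sol1_continuous c1 lh.
have [s0r s0i] := sol1_continuous c0 (Clocint0_sol1 c1 lh).
split=> [[u [v [[ur ui fu] [vr vi f1v] H]]]|H].
  have uE := eqL2_trans (eqL2_sym fu) E0; have vE := eqL2_trans (eqL2_sym f1v) E1.
  have u0 : u 0 = c0.
    rewrite -(sol1_at0 c0 (sol1 c1 h)); apply: complex_ext.
    - by apply: (continuous_eq_at0 s0r ur); apply: (ae_imp uE) => x K /K ->.
    - by apply: (continuous_eq_at0 s0i ui); apply: (ae_imp uE) => x K /K ->.
  have v0 : v 0 = c1.
    rewrite -(sol1_at0 c1 h); apply: complex_ext.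
    - by apply: (continuous_eq_at0 s1r vr); apply: (ae_imp vE) => x K /K ->.
    - by apply: (continuous_eq_at0 s1i vi); apply: (ae_imp vE) => x K /K ->.
  by rewrite u0 v0 in H.
exists (sol0 c0 c1 h), (sol1 c1 h); split.
- by split=> //; exact: continuous_subspaceT.
- by split=> //; exact: continuous_subspaceT.
- by rewrite -[sol0 _ _ _]/(sol1 c0 (sol1 c1 h)) !sol1_at0.
Qed.

Lemma weak_derivative2 f f1 f2 : weak_derivative f f1 -> weak_derivative f1 f2 ->
  Clocint0 f2 -> exists c0 c1, eqL2 f (sol0 c0 c1 f2) /\ eqL2 f1 (sol1 c1 f2).
Proof.
move=> w1 w2 l2.
have [c1 H1] := weak_derivative_prim w2 l2.
have l1 : Clocint0 (sol1 c1 f2) by exact: Clocint0_sol1.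
(* [f1] is replaced by its representative [sol1 c1 f2], which is integrable up to 0, so that [f] can
   be recovered as a primitive in turn. *)
have w1' : weak_derivative f (sol1 c1 f2).
  have [lf lf1 K] := w1; have L1 := Clocint0_locally_integrable l1.
  split=> // phi tphi; rewrite K//; congr (- _).
  have [_ cphi _] := test_functionP tphi.
  have md : measurable_fun Rpos phi.
    by apply: measurable_funS (continuous_measurable_fun cphi).
  have [[mhr _ _] [mhi _ _]] := lf1.
  have [[msr _ _] [msi _ _]] := L1.
  apply: Cint_ae.
  - by under eq_fun do rewrite Re_mul_real; exact: measurable_funM.
  - by under eq_fun do rewrite Im_mul_real; exact: measurable_funM.
  - by under eq_fun do rewrite Re_mul_real; exact: measurable_funM.
  - by under eq_fun do rewrite Im_mul_real; exact: measurable_funM.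
  - by apply: (ae_imp H1) => x E /E ->.
have [c0 H0] := weak_derivative_prim w1' l1.
by exists c0, c1.
Qed.

(** Each superlevel set at a rational height is Borel up to a null set. Setting [p] to 0 on the
    union [N] of these countably many null sets makes all superlevel sets Borel at once. *)
Lemma Lebesgue_measurable_ae_Borel (p : R -> R) (M : R) : Lebesgue_measurable_fun p ->
  (forall x, 0 < x -> `|p x| <= M) ->
  exists p' : R -> R, [/\ measurable_fun Rpos p', forall x, 0 < x -> `|p' x| <= M &
    ae_eq mu Rpos p p'].
Proof.
move=> mp pM.
have M0 : 0 <= M by apply: le_trans (pM 1 ltr01).
(* An enumeration of the rationals; the default 0 covers the integers that encode no rational. *)
pose rr (n : nat) : R := ratr (odflt 0 (unpickle n : option rat)).
pose S n := Rpos `&` p @^-1` `]rr n, +oo[.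
have [A [W HAW]] : exists A W : nat -> set R, forall n,
    [/\ measurable (A n), measurable (W n), mu (W n) = 0%E,
        A n `<=` S n & S n `<=` A n `|` W n].
  have H n : exists AW : set R * set R,
    [/\ measurable AW.1, measurable AW.2, mu AW.2 = 0%E,
        AW.1 `<=` S n & S n `<=` AW.1 `|` AW.2].
    have mR : (completed_algebra_gen mu).-sigma.-measurable Rpos.
      rewrite g_sigma_completed_algebra_genE; exists Rpos; first exact: measurable_Rpos.
      by exists set0; [exact: negligible_set0|rewrite setU0].
    have := mp mR `]rr n, +oo[%classic (measurable_itv _).
    rewrite -[X in X -> _]/((completed_algebra_gen mu).-sigma.-measurable (S n)).
    rewrite g_sigma_completed_algebra_genE => -[A mA [Z [W [mW W0 ZW]] AZ]].
    exists (A, W); split => //=; rewrite -AZ; first by move=> x Ax; left.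
    by move=> x [Ax|/ZW Wx]; [left|right].
  have [AW HAW] := choice H.
  by exists (fun n => (AW n).1), (fun n => (AW n).2).
pose N := \bigcup_n W n.
have mN : measurable N by apply: bigcup_measurable => n _; case: (HAW n).
have negN : mu.-negligible N.
  apply: negligible_bigcup => n; have [_ mW W0 _ _] := HAW n.
  by exists (W n); split.
exists (fun x => if x \in N then 0 else p x); split.
- move=> mR; apply: (measurability _ (RGenOInfty.measurableE R)) => // _ [_ [y ->] <-].
  (* Off [N], exceeding [y] means exceeding some rational above [y]. On [N] the new function is 0,
     so [N] counts exactly when [y < 0]. *)
  rewrite [X in measurable X](_ : _ =
    ((\bigcup_(n in [set n | y < rr n]) A n) `\` N) `|`
    (if y < 0 then N `&` Rpos else set0)).
    apply: measurableU; last by case: ifPn => // _; exact: measurableI.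
    by apply: measurableD => //; apply: bigcup_measurable => n _; case: (HAW n).
  apply/seteqP; split => [x [Rx]|x [[[n /= yn Anx] nNx]|]] /=.
  - rewrite in_itv/= andbT; case: ifPn => [|nN].
      by rewrite inE => Nx y0; right; rewrite y0.
    move=> /rat_in_itvoo[r]; rewrite in_itv/= => /andP[yr rp]; left.
    rewrite notin_setE in nN; split=> //; exists (pickle r); first by rewrite /= /rr pickleK.
    have [_ _ _ _ /(_ x)[]//] := HAW (pickle r);
      last by move=> Wx; case: nN; exists (pickle r).
    by split=> //=; rewrite in_itv/= andbT /rr pickleK.
  - have [_ _ _ /(_ x Anx)[Rx] + _] := HAW n; rewrite /= !in_itv/= !andbT => np.
    by split=> //; rewrite memNset//; exact: lt_trans np.
  - case: ifPn => // y0 [Nx Rx]; split=> //.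
    by rewrite mem_set//= in_itv/= y0.
- by move=> x x0; case: ifPn => // _; [rewrite normr0|exact: pM].
- apply: (@negligibleS _ _ _ mu _ _ _ negN) => x /= /not_implyP[Rx].
  by case: ifPn => // /set_mem.
Qed.

Lemma Cbounded_ae_Borel q : Cmeasurable q -> Cbounded q ->
  exists2 q' : R -> C, bounded_measurable q' & eqL2 q q'.
Proof.
move=> [mr mi] [M qM].
have le z : `|z| <= M%:C -> `|Re z| <= M /\ `|Im z| <= M.
  move=> zM; have zr := normc_ge_Re z.
  have zi := normc_ge_Re ('i%C * z).
  rewrite normrM (_ : `|'i%C| = 1) ?mul1r in zi; last first.
    by rewrite normc_def /= expr0n /= expr1n add0r sqrtr1.
  split; first by have := le_trans zr zM; rewrite lecR.
  have := le_trans zi zM; rewrite lecR; suff -> : Re ('i%C * z) = - Im z by rewrite normrN.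
  by rewrite Re_mul /= mul0r mul1r add0r.
have qr x : 0 < x -> `|Re (q x)| <= M by move=> /RposP/qM/le[].
have qi x : 0 < x -> `|Im (q x)| <= M by move=> /RposP/qM/le[].
have [pr [mpr prM er]] := Lebesgue_measurable_ae_Borel mr qr.
have [pi [mpi piM ei]] := Lebesgue_measurable_ae_Borel mi qi.
exists (fun x => pr x +i* pi x).
  by exists M; split=> // x x0; split; [exact: prM|exact: piM].
by apply: (ae_imp2 er ei) => x H K Rx; apply: complex_ext; [exact: H|exact: K].
Qed.

(** The working form of the operator: representatives and weak derivatives are replaced by initial
    data and a second derivative [h], and [q] by its Borel version. *)
Lemma schrodingerP q q' alpha f g : bounded_measurable q' -> eqL2 q q' ->
  schrodinger q alpha f g <-> [/\ L2 f, L2 g & exists c0 c1 h,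
    [/\ L2 h, L2 (sol1 c1 h), bc alpha c0 c1, eqL2 f (sol0 c0 c1 h) &
        eqL2 g (fun x => - h x + q' x * f x)]].
Proof.
move=> bq qq'.
split=> [[Lf Lg [f1 [f2 [w1 w2 L1 L2' [B E]]]]]|
         [Lf Lg [c0 [c1 [h [Lh L1 B E0 E]]]]]]; split=> //.
  have l2 := L2_locint0 L2'.
  have [c0 [c1 [E0 E1]]] := weak_derivative2 w1 w2 l2.
  exists c0, c1, f2; split=> //.
  - have [s1r s1i] := sol1_continuous c1 l2.
    apply: L2_ae L1 (eqL2_sym E1).
    + by apply: measurable_funS (continuous_measurable_fun s1r).
    + by apply: measurable_funS (continuous_measurable_fun s1i).
  - exact/(boundary_conditionP alpha l2 E0 E1).
  - by apply: (ae_imp2 E qq') => x H K Rx; rewrite H// K.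
have lh := L2_locint0 Lh.
exists (sol1 c1 h), h; split=> //.
- apply: weak_derivative_ae E0 Lf; apply: weak_derivative_sol1.
  exact: Clocint0_sol1.
- exact: weak_derivative_sol1.
- split; last by apply: (ae_imp2 E qq') => x H K Rx; rewrite H// K.
  apply/(boundary_conditionP alpha lh E0) => //.
  by apply: aeW.
Qed.

(** The equation itself expresses [e''] through [e] and [e^*] with bounded coefficients, so [e''] is
    in L^2; interpolation then yields [e']. *)
Lemma solves_schrodinger q alpha (lam : C) e : Cmeasurable q -> Cbounded q ->
  solves q alpha lam e -> schrodinger q alpha e (fun x => lam * (e x)^*).
Proof.
move=> mq bq [Le [e1 [e2 [w1 w2 B E]]]].
have [q' bq' qq'] := Cbounded_ae_Borel mq bq.
have Lg : L2 (fun x => lam * (e x)^*) by apply: L2Z; exact: L2J.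
have E2 : eqL2 e2 (fun x => q' x * e x - lam * (e x)^*).
  by apply: (ae_imp2 E qq') => x H K Rx; rewrite -H// K//; ring.
have [_ [[mr _ _] [mi _ _]] _] := w2.
have Le2 : L2 e2.
  apply: L2_ae mr mi _ E2; apply: L2B => //; exact: L2_bounded_mul.
have l2 := L2_locint0 Le2.
have [c0 [c1 [E0 E1]]] := weak_derivative2 w1 w2 l2.
apply/(schrodingerP alpha e _ bq' qq'); split=> //; exists c0, c1, e2.
have [s0r s0i] := sol1_continuous c0 (Clocint0_sol1 c1 l2).
have L0 : L2 (sol0 c0 c1 e2).
  apply: L2_ae Le (eqL2_sym E0).
  - by apply: measurable_funS (continuous_measurable_fun s0r).
  - by apply: measurable_funS (continuous_measurable_fun s0i).
split.
- exact: Le2.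
- exact: L2_interpolation L0 Le2.
- exact/(boundary_conditionP alpha l2 E0 E1).
- exact: E0.
- by apply: (ae_imp2 E qq') => x H K Rx; rewrite -H// K.
Qed.

End Operator.

(** * The adjoint and the modulus *)

Section Adjoint.
Context {R : realType}.
Local Notation mu := (@lebesgue_measure R).
Local Notation C := R[i].
Local Notation Re := (@complex.Re R).
Local Notation Im := (@complex.Im R).
Implicit Types (f g h k u v : R -> C) (D : set R) (c d z : C) (x : R).

Local Hint Resolve measurable_Rpos : core.

(** * Norm, inner product and graphs of adjoints *)

Definition L2norm2 f : R := \int[mu]_(x in Rpos) normsq (f x).

Lemma L2_conj f : L2 (fun x => (f x)^*) -> L2 f.
Proof.
by move=> /L2J; congr (L2 _); apply/funext => x; rewrite conjCK.
Qed.

Lemma inner_self f : inner f f = (L2norm2 f)%:C.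
Proof.
apply: complex_ext.
- by apply: eq_Rintegral => x _; rewrite !reimE /normsq; ring.
- transitivity (\int[mu]_(x in Rpos) (0 : R)).
    by apply: eq_Rintegral => x _; rewrite !reimE; ring.
  by rewrite /Rintegral integral0.
Qed.

Lemma L2normsqE f : L2 f -> L2normsq f = (L2norm2 f)%:E.
Proof. by move=> /L2_normsq_integ; exact: EFin_Rintegral. Qed.

Lemma L2norm2_ge0 f : 0 <= L2norm2 f.
Proof. by apply: Rintegral_ge0 => x _; rewrite addr_ge0 ?sqr_ge0. Qed.

Lemma L2norm2_eq0 f : L2 f -> L2norm2 f = 0 -> eqL2 f (fun=> 0).
Proof.
move=> Lf f0; have [fr fi _] := Lf.
have mf := normsq_measurable fr fi.
have H : (\int[mu]_(x in Rpos) `|(normsq (f x))%:E|)%E = 0%E.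
  transitivity (L2normsq f); last by rewrite L2normsqE// f0.
  by apply: eq_integral => x _; rewrite /= ger0_norm// addr_ge0 ?sqr_ge0.
have mE : measurable_fun Rpos (fun x : measurableTypeR R => (normsq (f x))%:E).
  exact/measurable_EFinP.
have := (ae_eq_integral_abs mu measurable_Rpos mE).1 H.
move=> /ae_imp; apply => x K Rx; have := K Rx => -[] /eqP.
rewrite paddr_eq0 ?sqr_ge0// !sqrf_eq0 => /andP[/eqP r0 /eqP i0].
exact: complex_ext.
Qed.

Lemma inner_ae f f' g g' : L2 f -> L2 f' -> L2 g -> L2 g' -> eqL2 f f' -> eqL2 g g' ->
  inner f g = inner f' g'.
Proof.
move=> Lf Lf' Lg Lg' ff gg.
have [ir ii] := L2_mul_integ Lf (L2J Lg); have [ir' ii'] := L2_mul_integ Lf' (L2J Lg').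
apply: Cint_ae; try exact: integ_measurable.
by apply: (ae_imp2 ff gg) => x H K Rx; rewrite H// K.
Qed.

Lemma innerZl c f g : L2 f -> L2 g -> inner (fun x => c * f x) g = c * inner f g.
Proof.
move=> Lf Lg; rewrite /inner -[Cintegral _]/(Cint Rpos _) -[X in _ = _ * X]/(Cint Rpos _).
rewrite -CintZ//; last by apply: L2_mul_integ => //; exact: L2J.
by apply: eq_Cint => x _; rewrite mulrA.
Qed.

Lemma innerZr c f g : L2 f -> L2 g -> inner f (fun x => c * g x) = c^* * inner f g.
Proof.
move=> Lf Lg; rewrite /inner -[Cintegral _]/(Cint Rpos _) -[X in _ = _ * X]/(Cint Rpos _).
rewrite -CintZ//; last by apply: L2_mul_integ => //; exact: L2J.
by apply: eq_Cint => x _; rewrite rmorphM/= mulrCA.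
Qed.

Lemma innerBl f g h : L2 f -> L2 g -> L2 h ->
  inner (fun x => f x - g x) h = inner f h - inner g h.
Proof.
move=> Lf Lg Lh; rewrite /inner -[Cintegral _]/(Cint Rpos _) -[X in _ = X - _]/(Cint Rpos _).
rewrite -[X in _ = _ - X]/(Cint Rpos _) -CintB//;
  [|by apply: L2_mul_integ => //; exact: L2J..].
by apply: eq_Cint => x _; rewrite mulrBl.
Qed.

Lemma innerBr f g h : L2 f -> L2 g -> L2 h ->
  inner f (fun x => g x - h x) = inner f g - inner f h.
Proof.
move=> Lf Lg Lh; rewrite /inner -[Cintegral _]/(Cint Rpos _) -[X in _ = X - _]/(Cint Rpos _).
rewrite -[X in _ = _ - X]/(Cint Rpos _) -CintB//;
  [|by apply: L2_mul_integ => //; exact: L2J..].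
by apply: eq_Cint => x _; rewrite rmorphB/= mulrBr.
Qed.

Definition in_L2 (T : (R -> C) -> (R -> C) -> Prop) := forall f g, T f g -> L2 f /\ L2 g.

Lemma adjointZ T c h k : in_L2 T -> adjoint T h k ->
  adjoint T (fun x => c * h x) (fun x => c * k x).
Proof.
move=> TL [Lh Lk H]; split; [exact: L2Z|exact: L2Z|] => f g Tfg.
have [Lf Lg] := TL _ _ Tfg.
by rewrite !innerZr// (H _ _ Tfg).
Qed.

Lemma adjointB T h k h' k' : in_L2 T -> adjoint T h k -> adjoint T h' k' ->
  adjoint T (fun x => h x - h' x) (fun x => k x - k' x).
Proof.
move=> TL [Lh Lk H] [Lh' Lk' H']; split; [exact: L2B|exact: L2B|] => f g Tfg.
have [Lf Lg] := TL _ _ Tfg.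
by rewrite !innerBr// (H _ _ Tfg) (H' _ _ Tfg).
Qed.

Lemma adjoint_ae T h k k' : in_L2 T -> adjoint T h k -> L2 k' -> eqL2 k k' ->
  adjoint T h k'.
Proof.
move=> TL [Lh Lk H] Lk' kk; split=> // f g Tfg.
have [Lf Lg] := TL _ _ Tfg.
rewrite (H _ _ Tfg); apply: inner_ae => //; exact: aeW.
Qed.

Lemma self_adjoint_in_L2 A : self_adjoint A -> in_L2 A.
Proof. by move=> [_ AA] f g /AA[]. Qed.

(* [A^2 f = lam^2 f] makes [v = A f - lam f] satisfy [A v = - lam v], so that
   [v = 0] as [A >= 0]. *)
Lemma nonnegative_sqr_eigen A (lam : R) f g : self_adjoint A -> nonnegative A -> 0 < lam ->
  A f g -> A g (fun x => lam%:C * (lam%:C * f x)) -> A f (fun x => lam%:C * f x).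
Proof.
move=> sA A0 lam0 Afg Agf.
have AL := self_adjoint_in_L2 sA; have [_ AA] := sA.
have [Lf Lg] := AL _ _ Afg.
pose v x := g x - lam%:C * f x.
have Lv : L2 v by apply: L2B => //; exact: L2Z.
have Av : A v (fun x => (- lam%:C) * v x).
  have := adjointB AL ((AA _ _).1 Agf) (adjointZ lam%:C AL ((AA _ _).1 Afg)).
  move=> /(AA _ _).2; congr (A _ _).
  by apply/funext => x; rewrite /v; ring.
have := A0 _ _ Av; rewrite innerZl// inner_self -rmorphN -rmorphM/= ler0c => H.
have v0 : L2norm2 v = 0.
  apply/eqP; rewrite eq_le L2norm2_ge0 andbT leNgt; apply/negP => vp.
  by move: H; rewrite mulNr oppr_ge0 leNgt mulr_gt0.
(* Being its own adjoint, [A] has a graph stable under almost everywhere changes of the value. *)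
apply/(AA _ _).2; apply: (adjoint_ae AL ((AA _ _).1 Afg)); first exact: L2Z.
apply: (ae_imp (L2norm2_eq0 Lv v0)) => x K Rx.
by have /eqP := K Rx; rewrite subr_eq0 => /eqP.
Qed.

Variables (q q' : R -> C) (alpha : option C).
Hypotheses (bq' : bounded_measurable q') (qq' : eqL2 q q').
Let T := schrodinger q alpha.

Let TP f g := @schrodingerP R q q' alpha f g bq' qq'.

Lemma schrodinger_in_L2 : in_L2 T.
Proof. by move=> f g []. Qed.

(** Both pairs of initial data lie on one and the same line of [C^2], so their determinant
    vanishes. *)
Lemma bc_wronskian a0 a1 b0 b1 : bc alpha a0 a1 -> bc alpha b0 b1 -> a0 * b1 - a1 * b0 = 0.
Proof.
rewrite /bc; case: alpha => [a|-> ->]; last by ring.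
move=> /eqP; rewrite addr_eq0 => /eqP -> /eqP; rewrite addr_eq0 => /eqP ->; ring.
Qed.

Lemma L2_sol0_ae f c0 c1 h : L2 h -> L2 f -> eqL2 f (sol0 c0 c1 h) -> L2 (sol0 c0 c1 h).
Proof.
move=> Lh Lf fE.
have [s0r s0i] := sol1_continuous c0 (Clocint0_sol1 c1 (L2_locint0 Lh)).
apply: L2_ae Lf (eqL2_sym fE).
- by apply: measurable_funS (continuous_measurable_fun s0r).
- by apply: measurable_funS (continuous_measurable_fun s0i).
Qed.

(** No conjugation occurs, so a complex [q] cancels. The Wronskian is then the primitive, starting
    from 0, of the remaining integrand, and it is integrable as a combination of products of L^2
    functions; hence the full integral is 0. *)
Lemma schrodinger_symmetric f g u v : T f g -> T u v ->
  Cint Rpos (fun x => g x * u x) = Cint Rpos (fun x => f x * v x).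
Proof.
move=> /TP[Lf Lg [a0 [a1 [h [Lh LF1 Ba fF gE]]]]] /TP[Lu Lv [b0 [b1 [w [Lw LU1 Bb uU vE]]]]].
pose F := sol0 a0 a1 h; pose U := sol0 b0 b1 w.
have LF : L2 F by exact: L2_sol0_ae fF.
have LU : L2 U by exact: L2_sol0_ae uU.
have lh := L2_locint0 Lh; have lw := L2_locint0 Lw.
have iwF := L2_mul_integ Lw LF; have ihU := L2_mul_integ Lh LU.
have Z : Cint Rpos (fun x => w x * F x - h x * U x) = 0.
  have i2 : Cinteg Rpos (fun x => w x * F x - h x * U x) by exact: CintegB.
  have := @Cint_derivative_Rpos R (a0 * b1 - a1 * b0) _ _ i2.
  rewrite (bc_wronskian Ba Bb) oppr0; apply.
  have := CintegB measurable_Rpos (L2_mul_integ LF LU1) (L2_mul_integ LF1 LU).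
  apply: eq_Cinteg => // x _.
  by rewrite (Lagrange_identity _ _ _ _ _ lh lw) (bc_wronskian Ba Bb).
have Lg' : L2 (fun x => - h x + q' x * F x) by apply: L2D; [exact: L2N|exact: L2_bounded_mul].
have Lv' : L2 (fun x => - w x + q' x * U x) by apply: L2D; [exact: L2N|exact: L2_bounded_mul].
have igU := L2_mul_integ Lg' LU; have iFv := L2_mul_integ LF Lv'.
have -> : Cint Rpos (fun x => g x * u x) = Cint Rpos (fun x => (- h x + q' x * F x) * U x).
  have [? ?] := L2_mul_integ Lg Lu; have [? ?] := igU.
  apply: Cint_ae; try exact: integ_measurable.
  have H2 := ae_imp2 gE fF (fun x H K (Rx : Rpos x) => conj (H Rx) (K Rx)).
  by apply: (ae_imp2 H2 uU) => x H K Rx; have [-> ->] := H Rx; rewrite K.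
have -> : Cint Rpos (fun x => f x * v x) = Cint Rpos (fun x => F x * (- w x + q' x * U x)).
  have [? ?] := L2_mul_integ Lf Lv; have [? ?] := iFv.
  apply: Cint_ae; try exact: integ_measurable.
  have H2 := ae_imp2 vE uU (fun x H K (Rx : Rpos x) => conj (H Rx) (K Rx)).
  by apply: (ae_imp2 H2 fF) => x H K Rx; have [-> ->] := H Rx; rewrite K.
apply/eqP; rewrite -subr_eq0 -CintB// -[X in _ == X]Z; apply/eqP; apply: eq_Cint => x _.
ring.
Qed.

Lemma schrodinger_conj_adjoint f g : T f g -> adjoint T (fun x => (f x)^*) (fun x => (g x)^*).
Proof.
move=> Tfg; have [Lf Lg] := schrodinger_in_L2 Tfg; split; [exact: L2J|exact: L2J|].
move=> u v Tuv; have := schrodinger_symmetric Tuv Tfg.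
rewrite /inner => E; transitivity (Cint Rpos (fun x => v x * f x)).
  by apply: eq_Cint => x _; rewrite conjCK.
by rewrite E; apply: eq_Cint => x _; rewrite conjCK.
Qed.

(** Serves for [F'] and for [F] alike, since [sol0 a0 a1 phi] unfolds to [sol1 a0 (sol1 a1 phi)]. *)
Lemma L2_sol1_support c h N : Clocint0 h -> (forall x, N <= x -> sol1 c h x = 0) ->
  L2 (sol1 c h).
Proof.
move=> lh s0.
have real (a : R) (p : R -> R) : locint0 p -> (forall x, N <= x -> a + prim p x = 0) ->
    L2r (fun x => a + prim p x).
  move=> lp p0; have la := locint0_prim a lp; split; first exact: locint0_measurable.
  apply: (@integ_support _ _ `]0, N]) => //.
  - by apply: subset_Rpos.
  - move=> x /RposP x0 /= /negP; rewrite in_itv/= x0/= -ltNge => /ltW Nx.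
    by rewrite p0// expr0n.
  - by apply: (eq_integ _ _ (locint0_mul_prim a la lp N)).
have /Clocint0P[hr hi] := lh.
apply/L2P; split.
- under eq_fun do rewrite /sol1 reimE; apply: real => // x Nx.
  by have /(congr1 Re) := s0 _ Nx; rewrite /sol1 reimE.
- under eq_fun do rewrite /sol1 reimE; apply: real => // x Nx.
  by have /(congr1 Im) := s0 _ Nx; rewrite /sol1 reimE.
Qed.

Lemma cprim_support h N x : Clocint0 h -> 0 <= N -> (forall t, N < t -> h t = 0) -> N <= x ->
  cprim h x = cprim h N.
Proof.
move=> lh N0 s Nx.
have E (r : R -> R) : (forall t, N < t -> r t = 0) -> prim r x = prim r N.
  move=> rs; apply: Rintegral_support.
    by move=> t /=; rewrite !in_itv/= => /andP[-> /le_trans]; apply.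
  move=> t /=; rewrite !in_itv/= => /andP[-> _]/= /negP; rewrite -ltNge; exact: rs.
by apply: complex_ext; apply: E => t /s ->.
Qed.

Lemma sol1_support h N x : Clocint0 h -> 0 <= N -> (forall t, N < t -> h t = 0) -> N <= x ->
  sol1 (- cprim h N) h x = 0.
Proof. by move=> lh N0 s Nx; rewrite /sol1 (cprim_support lh N0 s Nx) addNr. Qed.

(* Initial data of the affine function [bc_line] satisfying the boundary condition. *)
Definition bc_point : C * C := if alpha is Some a then (1, - a) else (0, 1).

Let p := bc_point.1.
Let s := bc_point.2.
Definition bc_line : R -> C := sol0 p s (fun=> 0).

Lemma bc_scale c : bc alpha (c * p) (c * s).
Proof. by rewrite /bc /p /s /bc_point; case: alpha => [a|] /=; ring. Qed.

(** Converse of [bc_wronskian]: [(p, s)] spans the line of admissible initial data, and a zero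
    determinant against it means lying on that line. *)
Lemma wronskian_bc a0 a1 : a0 * s - a1 * p = 0 -> bc alpha a0 a1.
Proof.
rewrite /bc /p /s /bc_point; case: alpha => [a|] /= => /eqP.
  rewrite mulr1 mulrN -opprD oppr_eq0 => /eqP <-; ring.
by rewrite mulr1 mulr0 subr0 => /eqP.
Qed.

Lemma Clocint0_0 : Clocint0 (fun=> 0 : C).
Proof. exact: Clocint0_cst. Qed.

Lemma cprim0 x : cprim (fun=> 0 : C) x = 0.
Proof. by apply: complex_ext; rewrite /= /Rintegral integral0. Qed.

Lemma cprim_cst c x : 0 <= x -> cprim (fun=> c) x = c * x%:C.
Proof.
move=> x0.
have E (r : R) : \int[mu]_(t in `]0, x]) r = r * x.
  rewrite Rintegral_cst//= lebesgue_measure_itv/= lte_fin.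
  case: ltP => //= [|x0']; first by rewrite subr0.
  by congr (_ * _); apply/eqP; rewrite eq_le x0 x0'.
by apply: complex_ext; rewrite ?Re_mul_real ?Im_mul_real; exact: E.
Qed.

Lemma bc_lineE x : 0 <= x -> bc_line x = p + s * x%:C.
Proof.
move=> x0; rewrite /bc_line /sol0 -(cprim_cst s x0); congr (_ + _).
by apply: eq_Cint => t _; rewrite /sol1 cprim0 addr0.
Qed.

(** A nonzero affine function has at most one zero, whereas the hypothesis provides a point in each
    half of []0, 1[]. *)
Lemma bc_line_neq0 c : {ae mu, forall x, 0 < x < 1 -> c * bc_line x = 0} -> c = 0.
Proof.
move=> H.
have h2 : (0 : R) < 2^-1 by rewrite invr_gt0.
have h1 : (2^-1 : R) < 1 by lra.
have [x1 /andP[x10 x1h] E1] := itv_not_negligible H h2.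
have [x2 /andP[x2h x21] E2] := itv_not_negligible H h1.
have x12 : x1 < x2 by exact: lt_trans x2h.
have x20 : 0 < x2 by exact: lt_trans x12.
have {}E1 : c * bc_line x1 = 0 by apply: E1; rewrite x10/=; lra.
have {}E2 : c * bc_line x2 = 0 by apply: E2; rewrite x20/=; lra.
rewrite !bc_lineE ?ltW// in E1 E2.
move: E1 E2; rewrite /p /s /bc_point; case: alpha => [a|] /= E1 E2; last first.
  move: E1; rewrite add0r mul1r => /eqP; rewrite mulf_eq0 => /orP[/eqP//|/eqP[]] H1.
  by rewrite H1 ltxx in x10.
have : c * a * (x1%:C - x2%:C) = 0.
  transitivity (c * (1 + - a * x2%:C) - c * (1 + - a * x1%:C)); first by ring.
  by rewrite E1 E2 subrr.
move/eqP; rewrite mulf_eq0 => /orP[/eqP ca|]; last first.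
  by rewrite subr_eq0 => /eqP[] H1; rewrite H1 ltxx in x12.
by rewrite -E1 mulrDr mulr1 mulrA mulrN ca oppr0 mul0r addr0.
Qed.

(** * The domain of the adjoint *)

Section AdjointDomain.
Variables (h k : R -> C).
Hypothesis hk : adjoint T (fun x => (h x)^*) (fun x => (k x)^*).

Lemma adjoint_conj_L2l : L2 h.
Proof. by have [/L2_conj]:= hk. Qed.

Let Lh := adjoint_conj_L2l.

Lemma adjoint_conj_L2r : L2 k.
Proof. by have [_ /L2_conj] := hk. Qed.

Let Lk := adjoint_conj_L2r.

(** Conjugating [h] and [k] in the hypothesis cancels the conjugation of [inner], which leaves the
    bilinear pairing that fits Lagrange's identity. *)
Lemma adjoint_conj_pairing f g : T f g ->
  Cint Rpos (fun x => g x * h x) = Cint Rpos (fun x => f x * k x).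
Proof.
move=> Tfg; have [_ _ /(_ _ _ Tfg)] := hk; rewrite /inner => E.
transitivity (Cint Rpos (fun x => g x * (h x)^*^*)).
  by apply: eq_Cint => x _; rewrite conjCK.
by rewrite [LHS]E; apply: eq_Cint => x _; rewrite conjCK.
Qed.

(* If [h] were smooth, [- h'' + q h = k] would read [h'' = w = W'']. *)
Let w x := q' x * h x - k x.
Let W := sol0 0 0 w.

Let Lw : L2 w := L2B (L2_bounded_mul bq' Lh) Lk.

Lemma Cint_support f N : 0 <= N -> (forall x, N < x -> f x = 0) ->
  Cint Rpos f = Cint `]0, N] f.
Proof.
move=> N0 f0; apply: complex_ext; apply: Rintegral_support; try exact: subset_Rpos.
- by move=> x /RposP x0 /= /negP; rewrite in_itv/= x0/= -ltNge => /f0 ->.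
- by move=> x /RposP x0 /= /negP; rewrite in_itv/= x0/= -ltNge => /f0 ->.
Qed.

(* Such a [phi] is [F''] for a compactly supported [F] in the domain of [T]. *)
Lemma adjoint_orthogonal phi N : 0 < N -> L2 phi -> (forall x, N < x -> phi x = 0) ->
  Cint `]0, N] (fun x => phi x * bc_line x) = 0 ->
  Cint `]0, N] (fun x => phi x * (h x - W x)) = 0.
Proof.
move=> N0 Lphi sphi orth; have N0' := ltW N0.
have lphi := L2_locint0 Lphi; have lw := L2_locint0 Lw.
(* The initial data are computed backwards, so that [F] and [F'] vanish from [N] on. Whether they
   satisfy the boundary condition is then decided by [orth]. *)
pose a1 := - cprim phi N; pose F1 := sol1 a1 phi.
have lF1 : Clocint0 F1 by exact: Clocint0_sol1.
have sF1 x : N <= x -> F1 x = 0 by exact: sol1_support.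
pose a0 := - cprim F1 N; pose F := sol0 a0 a1 phi.
have sF x : N <= x -> F x = 0.
  by apply: sol1_support => // t /ltW; exact: sF1.
have LF1 : L2 F1 by exact: (L2_sol1_support lphi sF1).
have LF : L2 F by exact: (L2_sol1_support lF1 sF).
have B : bc alpha a0 a1.
  apply: wronskian_bc.
  (* Lagrange's identity for [F] and [bc_line]: the Wronskian is 0 at [N] and the integral is 0 by
     [orth], so the determinant of initial data is 0. *)
  have := Lagrange_identity a0 a1 p s N lphi Clocint0_0.
  rewrite -/F -/F1 -/bc_line sF// sF1// !mul0r subrr => /eqP.
  rewrite eq_sym addr_eq0 => /eqP ->; apply/eqP; rewrite oppr_eq0; apply/eqP.
  have lpl : Clocint0 (fun x => phi x * bc_line x).
    by apply: Clocint0_sol0_mul => //; exact: Clocint0_0.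
  transitivity (Cint `]0, N] (fun x => - (phi x * bc_line x))).
    by apply: eq_Cint => x _; rewrite mul0r sub0r.
  by rewrite CintN// orth oppr0.
pose G x := - phi x + q' x * F x.
have LG : L2 G by apply: L2D; [exact: L2N|exact: L2_bounded_mul].
have TFG : T F G.
  apply/TP; split; [exact: LF|exact: LG|exists a0, a1, phi].
  by split; [exact: Lphi|exact: LF1|exact: B|exact: aeW|exact: aeW].
have H1 : cprim (fun x => w x * F x) N = cprim (fun x => phi x * h x) N.
  have i1 := L2_mul_integ Lphi Lh; have i2 := L2_mul_integ LF Lw.
  rewrite /cprim -!Cint_support//; last 2 first.
  - by move=> x /sphi ->; rewrite mul0r.
  - by move=> x /ltW /sF ->; rewrite mulr0.
  have := adjoint_conj_pairing TFG.
  have -> : Cint Rpos (fun x => G x * h x) =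
      Cint Rpos (fun x => (F x * w x + F x * k x) - phi x * h x).
    by apply: eq_Cint => x _; rewrite /G /w; ring.
  have i3 := L2_mul_integ LF Lk.
  rewrite CintB//; last exact: CintegD.
  rewrite CintD// addrAC => /eqP; rewrite -subr_eq0 addrK subr_eq0 => /eqP <-.
  by apply: eq_Cint => x _; rewrite mulrC.
(* For [F] and [W] both boundary terms vanish, at [N] by the support of [F] and at 0 by the zero
   data of [W]. Thus [w F] and [phi W] have equal integrals, as [w F] and [phi h] do by [H1]. *)
have := Lagrange_identity a0 a1 0 0 N lphi lw.
rewrite -/F -/F1 -/W sF// sF1// !mul0r subrr !mulr0 subrr add0r => /esym.
have lW : Clocint0 (fun x => phi x * W x) by exact: Clocint0_sol0_mul.
have lwF : Clocint0 (fun x => w x * F x) by exact: Clocint0_sol0_mul.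
have lph : Clocint0 (fun x => phi x * h x).
  move=> M; apply: (CintegS _ measurable_Rpos _ (L2_mul_integ Lphi Lh)) => //.
    exact: subset_Rpos.
rewrite (cprimB N lwF lW) H1 -(cprimB N lph lW) => <-.
by apply: eq_Cint => x _; rewrite mulrBr.
Qed.

(** Truncation brings [W] and [bc_line], which need not be in L^2 on the half-line, into the Hilbert
    space, so that projecting onto a line makes sense. *)
Definition cut N f x : C := f x * (\1_(`]0, N]%classic) x)%:C.

Lemma L2_cut N f : measurable_fun Rpos (fun x => Re (f x)) ->
  measurable_fun Rpos (fun x => Im (f x)) ->
  integ `]0, N] (fun x => Re (f x) ^+ 2) -> integ `]0, N] (fun x => Im (f x) ^+ 2) ->
  L2 (cut N f).
Proof.
have real (r : R -> R) : measurable_fun Rpos r -> integ `]0, N] (fun x => r x ^+ 2) ->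
    L2r (fun x => r x * \1_(`]0, N]%classic) x).
  move=> mr ir; split; first by apply: measurable_funM => //; exact: measurable_indic.
  apply: (@integ_support _ _ `]0, N]) => //.
  - by apply: subset_Rpos.
  - by move=> x _ xN; rewrite indicE memNset// mulr0 expr0n.
  - by apply: (eq_integ _ _ ir) => // x xN; rewrite indicE xN mulr1.
move=> mr mi ir ii; apply/L2P; split.
- by under eq_fun do rewrite Re_mul_real; exact: real.
- by under eq_fun do rewrite Im_mul_real; exact: real.
Qed.

Lemma L2_cut_L2 N f : L2 f -> L2 (cut N f).
Proof.
move=> /L2P[[mr ir] [mi ii]]; apply: L2_cut => //.
- by apply: integ_Rpos_locint0 ir _.
- by apply: integ_Rpos_locint0 ii _.
Qed.

Lemma L2_cut_sol1 N c f : Clocint0 f -> L2 (cut N (sol1 c f)).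
Proof.
move=> lf; have [cr ci] := sol1_continuous c lf.
have sq (r : R -> R) : continuous r -> integ `]0, N] (fun x => r x ^+ 2).
  move=> rc; apply: (@continuous_locint0 _ (fun x => r x ^+ 2)) => x.
  by apply: (@continuous_comp _ _ _ r (fun y => y ^+ 2)); [exact: rc|exact: exprn_continuous].
apply: L2_cut; [| |exact: sq|exact: sq].
- by apply: measurable_funS (continuous_measurable_fun cr).
- by apply: measurable_funS (continuous_measurable_fun ci).
Qed.

(* [h - W], minus its projection on [bc_line], is an admissible [phi] up to
   conjugation, hence is orthogonal to itself. *)
Lemma adjoint_line N : 1 <= N ->
  exists c, {ae mu, forall x, 0 < x <= N -> h x - W x = c * bc_line x}.
Proof.
move=> N1; have N0 : 0 < N by exact: lt_le_trans N1.
pose D1 := cut N (fun x => h x - W x); pose l1 := cut N bc_line.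
have cutE f x : 0 < x <= N -> cut N f x = f x.
  by move=> xN; rewrite /cut indicE mem_set ?mulr1//= in_itv.
have cut0 f x : N < x -> cut N f x = 0.
  move=> Nx; rewrite /cut indicE memNset ?mulr0//= in_itv/= => /andP[_].
  by rewrite leNgt Nx.
have LD : L2 D1.
  have H := L2B (L2_cut_L2 N Lh) (L2_cut_sol1 N 0 (Clocint0_sol1 0 (L2_locint0 Lw))).
  by move: H; congr (L2 _); apply/funext => x; rewrite /D1 /cut mulrBl.
have Ll : L2 l1 by exact: (L2_cut_sol1 N p (Clocint0_sol1 s Clocint0_0)).
have S0 : L2norm2 l1 != 0.
  apply/eqP => /(L2norm2_eq0 Ll) H.
  suff : (1 : C) = 0 by move/eqP; rewrite oner_eq0.
  apply: bc_line_neq0; apply: (ae_imp H) => x K /andP[x0 x1].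
  have xN : 0 < x <= N by rewrite x0 (le_trans (ltW x1)).
  by rewrite mul1r -(cutE bc_line x xN); exact: K ((RposP x).2 x0).
(* The projection coefficient; it is conjugated because [inner] is antilinear in its second
   argument. *)
pose c := (inner l1 D1 / (L2norm2 l1)%:C)^*.
pose E x := D1 x - c * l1 x.
have LE : L2 E by apply: L2B => //; exact: L2Z.
have l1E : inner l1 E = 0.
  rewrite innerBr//; last exact: L2Z.
  rewrite innerZr// inner_self conjCK divfK ?subrr//.
  by apply: contra S0 => /eqP[->].
have sE x : N < x -> (E x)^* = 0.
  by move=> Nx; rewrite /E /D1 /l1 !cut0// mulr0 subrr rmorph0.
have toinner f : Cint `]0, N] (fun x => (E x)^* * f x) = inner (cut N f) E.
  rewrite /inner -[RHS]/(Cint Rpos _) (@Cint_support _ N)//; [|exact: ltW|].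
    apply: eq_Cint => x; rewrite inE/= in_itv/= => xN.
    by rewrite cutE// mulrC.
  by move=> x Nx; rewrite cut0// mul0r.
have D1E : inner D1 E = 0.
  rewrite -toinner; apply: adjoint_orthogonal => //; first exact: L2J.
  by rewrite toinner.
have : inner E E = 0.
  rewrite {1}/E innerBl//; last exact: L2Z.
  by rewrite innerZl// l1E D1E mulr0 subrr.
rewrite inner_self => -[] /(L2norm2_eq0 LE) EE.
exists c; apply: (ae_imp EE) => x K xN.
have /eqP := K ((RposP x).2 (andP xN).1).
by rewrite subr_eq0 /D1 /l1 !cutE// => /eqP.
Qed.

(** The constants found for different [N] agree, since all the intervals contain []0, 1[], where
    [bc_line_neq0] applies. *)
Lemma adjoint_line_Rpos : exists c, eqL2 (fun x => h x - W x) (fun x => c * bc_line x).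
Proof.
have [c Hc] := adjoint_line (lexx 1).
have H (n : nat) : {ae mu, forall x, 0 < x <= n.+1%:R -> h x - W x = c * bc_line x}.
  have n1 : 1 <= n.+1%:R :> R by rewrite ler1n.
  have [c' Hc'] := adjoint_line n1.
  suff : c' - c = 0 by move/eqP; rewrite subr_eq0 => /eqP <-.
  apply: bc_line_neq0; apply: (ae_imp2 Hc Hc') => x H1 H2 /andP[x0 x1].
  rewrite mulrBl -H1 ?x0 ?ltW// -H2 ?subrr// x0 /=.
  exact: le_trans (ltW x1) n1.
exists c; apply: (ae_imp (@ae_foralln _ _ _ mu _ H)) => x /= Hx /RposP x0.
apply: (Hx (Num.bound x)); rewrite x0/=; apply: ltW.
by apply: lt_le_trans (archi_boundP (ltW x0)) _; rewrite ler_nat.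
Qed.

Lemma adjoint_conj_schrodinger : T h k.
Proof.
have [c Hc] := adjoint_line_Rpos.
have lw := L2_locint0 Lw.
have hE : eqL2 h (sol0 (c * p) (c * s) w).
  apply: (ae_imp Hc) => x K Rx; have x0 : 0 < x by exact/RposP.
  have -> : h x = W x + c * bc_line x by rewrite -K//; ring.
  rewrite bc_lineE ?ltW// /W /sol0.
  (* Raising the initial slope by [c * s] adds a linear term; with the initial value [c * p] this is
     [W] plus [c] times [bc_line]. *)
  have -> : cprim (sol1 (c * s) w) x = cprim (sol1 0 w) x + c * s * x%:C.
    rewrite -(cprim_cst _ (ltW x0)) -cprimD; [|exact: Clocint0_sol1|exact: Clocint0_cst].
    by apply: eq_Cint => t _; rewrite /sol1; ring.
  ring.
have L0 := L2_sol0_ae Lw Lh hE.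
apply/TP; split; [exact: Lh|exact: Lk|exists (c * p), (c * s), w; split].
- exact: Lw.
- exact: L2_interpolation L0 Lw.
- exact: bc_scale.
- exact: hE.
- by apply: aeW => x _; rewrite /w; ring.
Qed.

End AdjointDomain.

Lemma conjK_fun f : (fun x => ((f x)^*)^*) = f.
Proof. by apply/funext => x; rewrite conjCK. Qed.

Lemma adjoint_schrodinger_conj f g : adjoint T f g ->
  T (fun x => (f x)^*) (fun x => (g x)^*).
Proof. by move=> H; apply: adjoint_conj_schrodinger; rewrite !conjK_fun. Qed.

(** Through [T = J T^* J] the claim is transported to an adjoint, whose graph is visibly stable
    under almost everywhere changes; [schrodingerZ] is obtained in the same way. *)
Lemma schrodinger_ae f g g' : T f g -> L2 g' -> eqL2 g g' -> T f g'.
Proof.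
move=> Tfg Lg' gg'; have [Lf Lg] := schrodinger_in_L2 Tfg.
rewrite -(conjK_fun f) -(conjK_fun g'); apply: adjoint_schrodinger_conj.
apply: (adjoint_ae schrodinger_in_L2 (schrodinger_conj_adjoint Tfg)); first exact: L2J.
by apply: (ae_imp gg') => x H /H ->.
Qed.

Lemma schrodingerZ c f g : T f g -> T (fun x => c * f x) (fun x => c * g x).
Proof.
move=> /schrodinger_conj_adjoint/(adjointZ c^* schrodinger_in_L2)/adjoint_schrodinger_conj.
congr (T _ _); apply/funext => x; by rewrite rmorphM /= !conjCK.
Qed.

(** * Eigenfunctions of the modulus *)

Variables (A : (R -> C) -> (R -> C) -> Prop) (lam : R).
Hypotheses (AT : is_modulus A T) (lam0 : 0 < lam).

Let lamC : C := lam%:C.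

Lemma lamCJ : lamC^* = lamC.
Proof. by apply: complex_ext; rewrite !reimE/= ?oppr0. Qed.

(* Since [T^*] is [T] conjugated, [T e = lam e^*] implies [T^* T e = lam^2 e]. *)
Lemma antilinear_modulus_eigen e : T e (fun x => lamC * (e x)^*) -> A e (fun x => lamC * e x).
Proof.
have [sA nA AA] := AT.
move=> Te; have aT := adjointZ lamC schrodinger_in_L2 (schrodinger_conj_adjoint Te).
have E : (fun x => lamC * (lamC * (e x)^*)^*) = (fun x => lamC * (lamC * e x)).
  by apply/funext => x; rewrite rmorphM /= conjCK lamCJ.
have : opcomp (adjoint T) T e (fun x => lamC * (lamC * e x)).
  by exists (fun x => lamC * (e x)^*) => //; rewrite -E.
by move=> /AA[g Aeg Ag]; exact: nonnegative_sqr_eigen Ag.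
Qed.

(* If [T^* T f0 = lam^2 f0] then [(T f0)^*] is an eigenvector of [T^* T] too. *)
Lemma modulus_eigen_antilinear f0 : A f0 (fun x => lamC * f0 x) -> ~ eqL2 f0 (fun=> 0) ->
  (forall f, Defs.eigenspace A lamC f -> exists c, eqL2 f (fun x => c * f0 x)) ->
  exists d, d * d^* = lamC * lamC /\ T f0 (fun x => d * (f0 x)^*).
Proof.
move=> Af0 nz simple; have [sA nA AA] := AT.
have AL := self_adjoint_in_L2 sA; have [_ Aadj] := sA.
have [Lf0 _] := AL _ _ Af0.
have Af1 := (Aadj _ _).2 (adjointZ lamC AL ((Aadj _ _).1 Af0)).
have /AA[g Tf0g adjg] : opcomp A A f0 (fun x => lamC * (lamC * f0 x)).
  by exists (fun x => lamC * f0 x).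
have [_ Lg] := schrodinger_in_L2 Tf0g.
have Tg := adjoint_schrodinger_conj adjg.
(* [T] sends [g^*] to [lam^2 f0^*] by [Tg], and the adjoint sends [f0^*] to [g^*]; composed, they
   give [T^* T g^* = lam^2 g^*]. *)
have aT := adjointZ lamC schrodinger_in_L2
  (adjointZ lamC schrodinger_in_L2 (schrodinger_conj_adjoint Tf0g)).
have : opcomp A A (fun x => (g x)^*) (fun x => lamC * (lamC * (g x)^*)).
  apply/AA; exists (fun x => (lamC * (lamC * f0 x))^*) => //.
  have -> : (fun x => (lamC * (lamC * f0 x))^*) = (fun x => lamC * (lamC * (f0 x)^*)) => //.
  by apply/funext => x; rewrite !rmorphM /= lamCJ.
move=> [g1 Ag1 Ag2].
have [c Hc] := simple _ (nonnegative_sqr_eigen sA nA lam0 Ag1 Ag2).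
pose d := c^*.
have gE : eqL2 g (fun x => d * (f0 x)^*).
  by apply: (ae_imp Hc) => x K Rx; rewrite -[g x]conjCK K// rmorphM.
have LJ : L2 (fun x => d * (f0 x)^*) by apply: L2Z; exact: L2J.
exists d; split; last exact: schrodinger_ae Tf0g LJ gE.
(* The adjoint relation at [f0] itself equates the squared norm of [T f0] with [lam^2] times that of
   [f0], which fixes [|d|]. *)
have [_ _ /(_ _ _ Tf0g)] := adjg.
rewrite (inner_ae Lg LJ Lg LJ gE gE) innerZl//; last exact: L2J.
rewrite (innerZr d (L2J Lf0) (L2J Lf0)).
rewrite (innerZr lamC Lf0 (L2Z lamC Lf0)) (innerZr lamC Lf0 Lf0).
rewrite lamCJ !inner_self.
have -> : L2norm2 (fun x => (f0 x)^*) = L2norm2 f0.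
  by apply: eq_Rintegral => x _; rewrite /normsq !reimE sqrrN.
rewrite !mulrA => /mulIf; apply; apply/eqP => -[] /(L2norm2_eq0 Lf0); exact: nz.
Qed.

Lemma simple_modulus_eigenfunction : Cmeasurable q -> Cbounded q -> simple_eigenvalue A lamC ->
  exists e, [/\ normalised e, solves q alpha lamC e &
    forall e', normalised e' -> solves q alpha lamC e' ->
      eqL2 e' e \/ eqL2 e' (fun x => - e x)].
Proof.
move=> mq bq [f0 [Af0 nz simple]]; have [sA nA AA] := AT.
have [Lf0 _] := self_adjoint_in_L2 sA Af0.
have [d [dd Tf0]] := modulus_eigen_antilinear Af0 nz simple.
have lam_neq0 : lamC != 0 by apply/eqP => -[] H; have := lam0; rewrite H ltxx.
have d0 : d != 0.
  apply/eqP => H; move: dd; rewrite H mul0r => /esym/eqP.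
  by rewrite mulf_eq0 (negbTE lam_neq0).
pose n := L2norm2 f0.
have n0 : 0 < n.
  rewrite lt_def L2norm2_ge0 andbT; apply/eqP => /(L2norm2_eq0 Lf0); exact: nz.
(* [T] is linear and conjugation antilinear, so a unimodular factor [t] on [f0] multiplies [d] by
   [t^2]; this is why a square root is taken. *)
pose t := sqrtc (lamC / d).
have tt : t ^+ 2 * d = lamC by rewrite sqr_sqrtc divfK.
(* Taking moduli in [t^2 d = lam] gives [|t|^4 = 1], and the factor [|t|^2 + 1] cannot vanish. *)
have tJ : t * t^* = 1.
  have : (t * t^* - 1) * (t * t^* + 1) = 0.
    have : (t * t^* ) ^+ 2 * (d * d^*) = lamC * lamC.
      by rewrite -{2}lamCJ -tt rmorphM rmorphXn /=; ring.
    rewrite dd -[X in _ = X]mul1r => /mulIf E.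
    have {}E : (t * t^*) ^+ 2 = 1 by apply: E; rewrite mulf_neq0.
    by rewrite -subr_sqr E expr1n subrr.
  move/eqP; rewrite mulf_eq0 => /orP[|]; first by rewrite subr_eq0 => /eqP.
  by rewrite gt_eqF// ltr_wpDl// mul_conjC_ge0.
pose r := (Num.sqrt n)^-1.
pose z := r%:C * t.
have rJ : (r%:C)^* = r%:C :> C by apply: complex_ext; rewrite !reimE/= ?oppr0.
have zd : z * d = lamC * z^*.
  rewrite /z rmorphM /= rJ -tt; transitivity (r%:C * d * t * (t * t^*)); last by ring.
  by rewrite tJ mulr1; ring.
have zz : z * z^* = (n^-1)%:C.
  rewrite /z rmorphM /= rJ; transitivity (r%:C * r%:C * (t * t^*)); first by ring.
  by rewrite tJ mulr1 -rmorphM/= /r -invfM -expr2 sqr_sqrtr ?ltW.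
have nZ c f : L2 f -> (L2norm2 (fun x => c * f x))%:C = c * c^* * (L2norm2 f)%:C.
  by move=> Lf; rewrite -!inner_self innerZl ?innerZr ?mulrA//; exact: L2Z.
pose e x := z * f0 x.
have Le : L2 e by exact: L2Z.
have ne : L2norm2 e = 1.
  by have := nZ z f0 Lf0; rewrite zz -rmorphM/= mulVf ?gt_eqF// => -[].
have Te : T e (fun x => lamC * (e x)^*).
  have := schrodingerZ z Tf0; congr (T _ _); apply/funext => x.
  by rewrite /e rmorphM /= !mulrA zd.
exists e; split.
- by rewrite /normalised L2normsqE// ne.
- have [_ _ [f1 [f2 [w1 w2 _ _ [B E]]]]] := Te.
  by split=> //; exists f1, f2; split=> //; exact: eqL2_sym.
move=> e' ne' se'; have [Le' _] := se'.
have Te' := solves_schrodinger mq bq se'.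
have [c Hc] := simple _ (antilinear_modulus_eigen Te').
have z0 : z != 0.
  by apply/eqP => H; move: zz; rewrite H mul0r => -[] /esym/eqP; rewrite invr_eq0 gt_eqF.
pose k := c / z.
have Hk : eqL2 e' (fun x => k * e x).
  by apply: (ae_imp Hc) => x K Rx; rewrite K// /k /e mulrA divfK.
have Lke : L2 (fun x => k * e x) by exact: L2Z.
have kk : k * k^* = 1.
  have := nZ k e Le; rewrite ne mulr1 => <-.
  move: ne'; rewrite /normalised L2normsqE// => -[].
  rewrite /L2norm2 => E; have := inner_ae Le' Lke Le' Lke Hk Hk.
  by rewrite !inner_self /L2norm2 E => <-.
have kJ : k^* = k.
  have S := schrodinger_symmetric Te Te'.
  have I1 : Cint Rpos (fun x => lamC * (e x)^* * e' x) = lamC * inner e' e.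
    rewrite /inner -[X in _ = _ * X]/(Cint Rpos _) -CintZ//.
      by apply: eq_Cint => x _; rewrite -mulrA [in LHS](mulrC _^*).
    by apply: L2_mul_integ => //; exact: L2J.
  have I2 : Cint Rpos (fun x => e x * (lamC * (e' x)^*)) = lamC * inner e e'.
    rewrite /inner -[X in _ = _ * X]/(Cint Rpos _) -CintZ//.
      by apply: eq_Cint => x _; rewrite mulrCA.
    by apply: L2_mul_integ => //; exact: L2J.
  have ee : eqL2 e e by exact: aeW.
  move: S; rewrite I1 I2 => /(mulfI lam_neq0).
  rewrite (inner_ae Le' Lke Le Le Hk ee) (inner_ae Le Le Le' Lke ee Hk).
  by rewrite innerZl// innerZr// inner_self ne !mulr1.
(* A real number of modulus 1 is 1 or -1. *)
have : (k - 1) * (k + 1) = 0 by rewrite -subr_sqr expr1n expr2 -{2}kJ kk subrr.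
move/eqP; rewrite mulf_eq0 subr_eq0 addr_eq0 => /orP[/eqP k1|/eqP k1].
- by left; apply: (ae_imp Hk) => x K Rx; rewrite K// k1 mul1r.
- by right; apply: (ae_imp Hk) => x K Rx; rewrite K// k1 mulN1r.
Qed.

End Adjoint.

Theorem lemma1p12 (R : realType) (q : R -> R[i]) (alpha : option R[i])
    (q_measurable : Cmeasurable q) (q_bounded : Cbounded q)
    (absH : (R -> R[i]) -> (R -> R[i]) -> Prop)
    (absH_modulus : is_modulus absH (schrodinger q alpha))
    (lambda : R) (lambda_gt0 : 0 < lambda)
    (lambda_simple : simple_eigenvalue absH lambda%:C) :
  exists e : R -> R[i],
    [/\ normalised e, solves q alpha lambda%:C e &
      forall e' : R -> R[i], normalised e' -> solves q alpha lambda%:C e' ->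
        eqL2 e' e \/ eqL2 e' (fun x => - e x)].
Proof.
have [q' bq' qq'] := Cbounded_ae_Borel q_measurable q_bounded.
exact: (simple_modulus_eigenfunction bq' qq' absH_modulus).
Qed.
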